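(* Let $q=p^n$ with $p$ prime, and let $\phi:\mathit{GF}(q)\to\mathit{GF}(p)$ be any nonzero $\mathit{GF}(p)$-linear map. Then for every $\varepsilon\ge 0$, the operator $F_{q,\phi}$ can be performed with accuracy $\varepsilon$ by a quantum circuit of size $O(n^2(\log p)^2)+n\,C(p,\varepsilon/n)$.
   Context: $\mathit{GF}(q)$ is the finite field with $q=p^n$ elements, viewed as an $n$-dimensional vector space over $\mathit{GF}(p)$ (elements represented as polynomials over $\mathit{GF}(p)$ modulo a fixed irreducible polynomial of degree $n$), with elements encoded as $n$-tuples of $\mathit{GF}(p)$-valued registers. $F_{q,\phi}$ is the unitary defined by $F_{q,\phi}\ket{x}=\frac{1}{\sqrt q}\sum_{y\in \mathit{GF}(q)}\omega^{\phi(xy)}\ket{y}$, $\omega=e^{2\pi i/p}$. $C(p,\varepsilon)$ denotes the minimum size of a quantum circuit approximating the (usual cyclic) quantum Fourier transform modulo $p$, $\ket{a}\mapsto\frac{1}{\sqrt p}\sum_{b\in\mathbb{Z}_p}\omega^{ab}\ket{b}$, to within accuracy $\varepsilon$. *)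

(* Defs.v *)
From mathcomp Require Import all_boot all_order all_algebra.
From mathcomp Require Import reals trigo.
From mathcomp Require Import complex.
Set Implicit Arguments. Unset Strict Implicit. Unset Printing Implicit Defensive.
Import Order.TTheory GRing.Theory Num.Theory.
Local Open Scope ring_scope.
Local Open Scope complex_scope.

(* The finite field GF(p^n): row vectors of coefficients over 'F_p,    *)
(* multiplied as polynomials modulo a fixed irreducible polynomial P   *)
(* of degree n (size P = n.+1).                                        *)
Definition gf_mul (p n : nat) (P : {poly 'F_p}) (x y : 'rV['F_p]_n) : 'rV['F_p]_n :=
  poly_rV ((rVpoly x * rVpoly y) %% P).

Definition Fp_linear (p n : nat) (phi : 'rV['F_p]_n -> 'F_p) : Prop :=
  forall (a : 'F_p) (x y : 'rV['F_p]_n), phi (a *: x + y) = a * phi x + phi y.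

(* Quantum circuits on N qubits, amplitudes in R[i].                   *)
(* Basis states are bit assignments {ffun 'I_N -> bool}.               *)
(* A gate is an arbitrary unitary 4x4 matrix acting on two distinct    *)
(* qubits (i, j); the size of a circuit is its number of gates.        *)
Section Quantum.
Variable R : realType.
Local Notation C := R[i].

Definition state (N : nat) := {ffun {ffun 'I_N -> bool} -> C}.

Definition ket (N : nat) (b : {ffun 'I_N -> bool}) : state N :=
  [ffun b' => (b' == b)%:R].

Definition gate (N : nat) := ('M[C]_4 * 'I_N * 'I_N)%type.
Definition circuit (N : nat) := seq (gate N).

Definition unitary4 (U : 'M[C]_4) : bool :=
  U *m (map_mx Num.conj U)^T == 1%:M.

Definition gate_wf (N : nat) (g : gate N) : bool :=
  let: (U, i, j) := g in unitary4 U && (i != j).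

Definition circuit_wf (N : nat) (c : circuit N) : bool := all (@gate_wf N) c.

Definition idx2 (x y : bool) : 'I_4 := inord (2 * x + y)%N.

Definition setbits (N : nat) (b : {ffun 'I_N -> bool}) (i : 'I_N) (x : bool)
  (j : 'I_N) (y : bool) : {ffun 'I_N -> bool} :=
  [ffun k => if k == i then x else if k == j then y else b k].

Definition apply_gate (N : nat) (g : gate N) (psi : state N) : state N :=
  let: (U, i, j) := g in
  [ffun b : {ffun 'I_N -> bool} => \sum_(x : bool) \sum_(y : bool)
              U (idx2 (b i) (b j)) (idx2 x y) * psi (setbits b i x j y)].

Definition run (N : nat) (c : circuit N) (psi : state N) : state N :=
  foldl (fun s g => apply_gate g s) psi c.

Definition vnorm (N : nat) (psi : state N) : C :=
  sqrtC (\sum_b `|psi b| ^+ 2).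

(* Encoding of n GF(p)-valued registers into the first n*m qubits:
   qubit k < n*m holds bit (k mod m) of the binary expansion of register
   j = k div m (the sum below has exactly that single term j); the remaining qubits are ancillas (value 0). *)
Definition enc_regs (p n m N : nat) (x : 'rV['F_p]_n) : {ffun 'I_N -> bool} :=
  [ffun k : 'I_N => ((k < n * m)%N &&
      odd (\sum_(j < n | (j : nat) == (k %/ m)%N) ((x ord0 j : nat) %/ 2 ^ (k %% m))))].

(* The circuit c on N qubits performs the operator W (matrix entries
   W y x = <y|W|x>, on the register space indexed by 'rV['F_p]_n) with
   accuracy eps: for every normalized register state alpha, with all
   ancillas initialised to |0>, the output is within eps (Euclidean norm)
   of W alpha with all ancillas back in |0>. *)
Definition performs (p n m N : nat) (W : 'rV['F_p]_n -> 'rV['F_p]_n -> C)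
  (c : circuit N) (eps : R) : Prop :=
  (n * m <= N)%N /\
  forall alpha : 'rV['F_p]_n -> C,
    \sum_x `|alpha x| ^+ 2 = 1 ->
    vnorm (run c (\sum_x alpha x *: ket (enc_regs m N x))
           - \sum_y (\sum_x W y x * alpha x) *: ket (enc_regs m N y))
      <= eps%:C.

Definition qubits_per_reg (p : nat) : nat := up_log 2 p.

Definition omega (p : nat) : C :=
  cos (2 * pi / p%:R) +i* sin (2 * pi / p%:R).

Definition Fq_phi (p n : nat) (P : {poly 'F_p}) (phi : 'rV['F_p]_n -> 'F_p)
  (y x : 'rV['F_p]_n) : C :=
  ((Num.sqrt ((p ^ n)%:R : R))^-1)%:C * omega p ^+ (phi (gf_mul P x y) : nat).

Definition QFTp (p : nat) (b a : 'rV['F_p]_1) : C :=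
  ((Num.sqrt (p%:R : R))^-1)%:C * omega p ^+ ((a ord0 ord0 : nat) * (b ord0 ord0 : nat))%N.

(* "C(p, eps) <= k": some well-formed circuit of size k performs the
   QFT modulo p with accuracy eps. *)
Definition QFT_achievable (p : nat) (eps : R) (k : nat) : Prop :=
  exists (N : nat) (c : circuit N),
    circuit_wf c /\ size c = k /\ performs (qubits_per_reg p) (@QFTp p) c eps.

End Quantum.

(* Main.v *)
Require Import Defs.
From HB Require Import structures.
From mathcomp Require Import all_boot all_order all_algebra.
From mathcomp Require Import reals trigo.
From mathcomp Require Import complex zify ring lra.
Set Implicit Arguments. Unset Strict Implicit. Unset Printing Implicit Defensive.
Import Order.TTheory GRing.Theory Num.Theory.
Local Open Scope ring_scope.

(** Since [phi] is linear and nonzero and multiplication in GF(q) is a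
    nondegenerate bilinear map, [phi (x y) = \sum_j (x A)_j y_j] for an invertible
    matrix [A] over GF(p). Hence F_{q,phi} is the reversible linear map
    [x |-> x A] followed by one Fourier transform modulo [p] on each register.

    The coordinates of [x A] are sums modulo [p] of [n m] constants, each
    controlled by one bit of [x] ([m] is the number of bits per register), and
    adding a controlled constant modulo [p] costs O(m) Boolean operations. So
    [x |-> x A] and its inverse have Boolean circuits of size O(n^2 m^2), and
    computing [x A] next to [x], then erasing [x] by means of the inverse, yields
    an exact quantum circuit of that order.

    Each Fourier transform has accuracy [eps / n] on states of its own register;
    fixing the values of all other qubits splits any state orthogonally into such
    states, so the accuracy is the same on the full space, and unitarity makes the
    [n] errors add up to at most [eps]. *)

(** * Elementary gates *)

Arguments gate_wf : simpl never.

(** The map from [(b, v)] to [(put b v, get b)] is an involution of [B * V]. It serves to split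
    squared norms over the values of a few qubits or of one register. *)
Lemma sum_resample (B V : finType) (C : nmodType) (put : B -> V -> B) (get : B -> V)
    (F : B -> C) :
  (forall b v, get (put b v) = v) -> (forall b v, put (put b v) (get b) = b) ->
  \sum_b \sum_v F (put b v) = (\sum_b F b) *+ #|V|.
Proof.
move=> putK getK; rewrite pair_bigA /=.
rewrite (reindex_inj (h := fun bv : B * V => (put bv.1 bv.2, get bv.1))) /=; last first.
  by apply: inv_inj => -[b v] /=; rewrite getK putK.
under eq_bigr => bv _ do rewrite getK.
rewrite -(pair_bigA _ (fun b (_ : V) => F b)) /=.
by rewrite -sumrMnl; apply: eq_bigr => b _; rewrite sumr_const.
Qed.

Section Gates.
Variables (R : realType) (N : nat).
Local Notation C := R[i].
Local Notation bits := {ffun 'I_N -> bool}.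
Implicit Types (psi : state R N) (b : bits) (i j u v w : 'I_N) (c : circuit R N).

Definition hi4 (r : 'I_4) : bool := (2 <= r)%N.
Definition lo4 (r : 'I_4) : bool := odd r.

Lemma hi4_idx2 x y : hi4 (idx2 x y) = x.
Proof. by case: x; case: y; rewrite /hi4 /idx2 inordK. Qed.

Lemma lo4_idx2 x y : lo4 (idx2 x y) = y.
Proof. by case: x; case: y; rewrite /lo4 /idx2 inordK. Qed.

Lemma idx2K r : idx2 (hi4 r) (lo4 r) = r.
Proof. by apply: val_inj; case: r => -[|[|[|[|r]]]] //= lt_r; rewrite /idx2 inordK. Qed.

Lemma sum_idx2 (V : nmodType) (F : 'I_4 -> V) :
  \sum_r F r = \sum_(x : bool) \sum_(y : bool) F (idx2 x y).
Proof.
rewrite pair_bigA /= (reindex (fun xy : bool * bool => idx2 xy.1 xy.2)) //=.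
exists (fun r => (hi4 r, lo4 r)) => [[x y] _ | r _] /=; last exact: idx2K.
by rewrite hi4_idx2 lo4_idx2.
Qed.

Definition mx4 (f : bool -> bool -> bool -> bool -> C) : 'M[C]_4 :=
  \matrix_(r, s) f (hi4 r) (lo4 r) (hi4 s) (lo4 s).

Lemma mx4_unitary f :
  (forall x y x' y', \sum_(s : bool) \sum_(t : bool) f x y s t * Num.conj (f x' y' s t)
     = ((x == x') && (y == y'))%:R) -> unitary4 (mx4 f).
Proof.
move=> fU; apply/eqP/matrixP => r r'; rewrite !mxE sum_idx2 -[r]idx2K -[r']idx2K.
have -> : (idx2 (hi4 r) (lo4 r) == idx2 (hi4 r') (lo4 r')) =
          (hi4 r == hi4 r') && (lo4 r == lo4 r').
  apply/eqP/andP => [e | [/eqP-> /eqP->]] //.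
  by rewrite !idx2K in e; rewrite e !eqxx.
rewrite -fU; apply: eq_bigr => s _; apply: eq_bigr => t _.
by rewrite !mxE !hi4_idx2 !lo4_idx2.
Qed.

Lemma apply_mx4 f i j psi b :
  apply_gate (mx4 f, i, j) psi b =
  \sum_(x : bool) \sum_(y : bool) f (b i) (b j) x y * psi (setbits b i x j y).
Proof.
rewrite ffunE; apply: eq_bigr => x _; apply: eq_bigr => y _.
by rewrite mxE !hi4_idx2 !lo4_idx2.
Qed.

Definition setbit b i x : bits := [ffun k => if k == i then x else b k].

Lemma setbits_id b i x j y : i != j -> b i = x -> setbits b i x j y = setbit b j y.
Proof.
move=> nij <-; apply/ffunP => k; rewrite !ffunE.
by case: (k =P i) => // ->; rewrite (negbTE nij).
Qed.

Lemma setbit_id b i : setbit b i (b i) = b.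
Proof. by apply/ffunP => k; rewrite !ffunE; case: eqP => // ->. Qed.

Lemma setbit2 b i x y : setbit (setbit b i x) i y = setbit b i y.
Proof. by apply/ffunP => k; rewrite !ffunE; case: eqP. Qed.

Definition flip b i x := setbit b i (b i (+) x).

Lemma flip2 b i x : flip (flip b i x) i x = b.
Proof. by rewrite /flip setbit2 ffunE eqxx -addbA addbb addbF setbit_id. Qed.

(** [h := id] gives the controlled NOT; a constant [h] gives NOT or the identity on [i]. *)
Definition xor_gate (h : bool -> bool) u i : gate R N :=
  (mx4 (fun x y s t => ((x == s) && (y (+) h x == t))%:R), u, i).

Definition phase_gate (z : C) u i : gate R N :=
  (mx4 (fun x y s t => if (x == s) && (y == t) then z ^+ (x && y) else 0), u, i).

(** Here [u] is an idle partner, because every gate acts on two distinct qubits. *)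
Definition hadamard_gate u i : gate R N :=
  (mx4 (fun x y s t => (x == s)%:R * (-1) ^+ (y && t) / sqrtC 2), u, i).

Lemma xor_gate_wf h u i : u != i -> gate_wf (xor_gate h u i).
Proof.
move=> nui; rewrite /gate_wf /= nui andbT; apply: mx4_unitary => x y x' y'.
rewrite !big_bool /= !conjC_nat -!natrM -!natrD; congr _%:R.
by case: x; case: x'; case: y; case: y'; case: (h true); case: (h false).
Qed.

Lemma phase_gate_wf z u i : z * Num.conj z = 1 -> u != i -> gate_wf (phase_gate z u i).
Proof.
move=> nz nui; rewrite /gate_wf /= nui andbT; apply: mx4_unitary => x y x' y'.
rewrite !big_bool /=.
by case: x; case: x'; case: y; case: y';
  rewrite /= ?expr0 ?expr1 ?rmorph0 ?rmorph1 ?mulr0 ?mul0r ?mulr1 ?addr0 ?add0r.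
Qed.

Lemma hadamard_gate_wf u i : u != i -> gate_wf (hadamard_gate u i).
Proof.
move=> nui; rewrite /gate_wf /= nui andbT; apply: mx4_unitary => x y x' y'.
have s2 : (sqrtC 2)^-1 * Num.conj (sqrtC 2)^-1 = 2^-1 :> C.
  rewrite -normCK normrV ?unitfE ?sqrtC_eq0 ?pnatr_eq0 // exprVn.
  by rewrite ger0_norm ?sqrtC_ge0 ?ler0n // sqrtCK.
have -> : \sum_(s : bool) \sum_(t : bool)
    (x == s)%:R * (-1) ^+ (y && t) / sqrtC 2 *
    Num.conj ((x' == s)%:R * (-1) ^+ (y' && t) / sqrtC 2) =
  (\sum_(s : bool) \sum_(t : bool)
    (x == s)%:R * (-1) ^+ (y && t) * ((x' == s)%:R * (-1) ^+ (y' && t))) / 2 :> C.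
  rewrite mulr_suml; apply: eq_bigr => s _; rewrite mulr_suml; apply: eq_bigr => t _.
  rewrite !rmorphM /= rmorphXn /= rmorphN1 conjC_nat -s2; ring.
rewrite !big_bool /=.
have n2 : 2 != 0 :> C by rewrite pnatr_eq0.
by case: x; case: x'; case: y; case: y' => /=; rewrite ?expr0 ?expr1; field.
Qed.

Lemma xor_gateE h u i psi b : u != i ->
  apply_gate (xor_gate h u i) psi b = psi (flip b i (h (b u))).
Proof.
move=> nui; rewrite apply_mx4 !big_bool /= /flip.
by case Eu: (b u); case: (b i); case: (h _);
  rewrite /= ?mul0r ?mul1r ?addr0 ?add0r (setbits_id _ nui Eu).
Qed.

Lemma phase_gateE z u i psi b : u != i ->
  apply_gate (phase_gate z u i) psi b = z ^+ (b u && b i) * psi b.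
Proof.
move=> nui; rewrite apply_mx4 !big_bool /=.
have -> : psi b = psi (setbit b i (b i)) by rewrite setbit_id.
by case Eu: (b u); case Ei: (b i);
  rewrite /= ?mul0r ?mul1r ?addr0 ?add0r (setbits_id _ nui Eu).
Qed.

Lemma hadamard_gateE u i psi b : u != i ->
  apply_gate (hadamard_gate u i) psi b =
  (psi (setbit b i false) + (-1) ^+ (b i) * psi (setbit b i true)) / sqrtC 2.
Proof.
move=> nui; rewrite apply_mx4 !big_bool /=.
case Eu: (b u); case: (b i);
  rewrite /= ?mul0r ?mul1r ?addr0 ?add0r !(setbits_id _ nui Eu) ?expr0 ?expr1; ring.
Qed.

Lemma run_cat c1 c2 psi : run (c1 ++ c2) psi = run c2 (run c1 psi).
Proof. by rewrite /run foldl_cat. Qed.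

Lemma circuit_wf_cat c1 c2 : circuit_wf (c1 ++ c2) = circuit_wf c1 && circuit_wf c2.
Proof. exact: all_cat. Qed.

Definition ccz u v i : circuit R N :=
  [:: phase_gate 'i v i; xor_gate id u v; phase_gate (- 'i) v i; xor_gate id u v;
      phase_gate 'i u i].

(** Hadamard gates on the target turn the doubly controlled Z of [ccz] into a doubly controlled
    NOT. *)
Definition toffoli u v i : circuit R N :=
  hadamard_gate u i :: rcons (ccz u v i) (hadamard_gate u i).

Lemma toffoli_wf u v i : u != v -> u != i -> v != i -> circuit_wf (toffoli u v i).
Proof.
move=> nuv nui nvi; rewrite /circuit_wf /toffoli /ccz /=.
have iU : 'i * Num.conj 'i = 1 :> C by rewrite conjCi mulrN -expr2 sqrCi opprK.
rewrite !hadamard_gate_wf // !xor_gate_wf // !phase_gate_wf //.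
by rewrite rmorphN /= mulrNN.
Qed.

(* The phases of [ccz] add up because v + u - (u (+) v) = 2 u v. *)
Lemma cczE u v i psi b : u != v -> u != i -> v != i ->
  run (ccz u v i) psi b = (-1) ^+ [&& b u, b v & b i] * psi b.
Proof.
move=> nuv nui nvi; rewrite /run /= phase_gateE // xor_gateE // phase_gateE //.
rewrite xor_gateE // phase_gateE //.
have fu : flip b v (b u) u = b u by rewrite ffunE (negbTE nuv).
rewrite fu flip2 !ffunE eqxx eq_sym (negbTE nvi) !mulrA; congr (_ * _).
have i2 : 'i * 'i = -1 :> C by rewrite -expr2 sqrCi.
by case: (b u); case: (b v); case: (b i); rewrite /= ?expr0 ?expr1 ?mulr1 ?mul1r ?mulrN ?mulNr ?i2 ?opprK.
Qed.

Lemma toffoliE u v i psi b : u != v -> u != i -> v != i ->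
  run (toffoli u v i) psi b = psi (flip b i (b u && b v)).
Proof.
move=> nuv nui nvi.
rewrite /toffoli -cat1s -cats1 catA !run_cat [in LHS]/run /=.
rewrite [LHS]hadamard_gateE // -/(run _ _) !cczE // !hadamard_gateE //.
rewrite !ffunE !eqxx (negbTE nui) (negbTE nvi) !setbit2 /flip.
have s2 : (sqrtC 2)^-1 * (sqrtC 2)^-1 = 2^-1 :> C by rewrite -expr2 exprVn sqrtCK.
have half : 2^-1 + 2^-1 = 1 :> C by field.
rewrite !andbF !andbT !expr0 !mul1r.
set p0 := psi _; set p1 := psi _; set s := (sqrtC 2)^-1 in s2 *.
have e z : (s * s + s * s) * z = z by rewrite s2 half mul1r.
case: (b u && b v) (b i) => -[] /=; rewrite ?expr0 ?expr1 -/p0 -/p1.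
- by rewrite -[RHS]e; ring.
- by rewrite -[RHS]e; ring.
- by rewrite -[RHS]e; ring.
by rewrite -[RHS]e; ring.
Qed.

(** Precomposing amplitudes with [tau] moves basis states by the inverse of [tau], which is [tau]
    itself. *)
Lemma run_ket c (tau : bits -> bits) b :
  involutive tau -> (forall psi b', run c psi b' = psi (tau b')) ->
  run c (ket R b) = ket R (tau b).
Proof.
move=> tauK cE; apply/ffunP => b'; rewrite cE !ffunE.
by congr _%:R; rewrite -{1}(tauK b) (inj_eq (inv_inj tauK)).
Qed.

Lemma apply_gate_linear (g : gate R N) : linear (apply_gate g).
Proof.
move=> a psi psi'; case: g => -[U i] j; apply/ffunP => b; rewrite !ffunE.
rewrite scaler_sumr -big_split; apply: eq_bigr => x _ /=.
rewrite scaler_sumr -big_split; apply: eq_bigr => y _ /=.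
by rewrite !ffunE mulrDr /GRing.scale /= mulrCA.
Qed.

Lemma run_linear c : linear (run c).
Proof.
move=> a psi psi'; elim: c psi psi' => //= g c IHc psi psi'.
by rewrite apply_gate_linear IHc.
Qed.

HB.instance Definition _ c := GRing.isLinear.Build C (state R N) (state R N) _ (run c) (run_linear c).

End Gates.

(** * Norms and unitarity *)

Section Norms.
Variable R : realType.
Local Notation C := R[i].

(** The squared modulus is taken in [R], so that estimates live in a total order instead of the
    partial order of [R[i]]. *)
Definition nsq (z : C) : R := (complex.Re z) ^+ 2 + (complex.Im z) ^+ 2.

Definition sqn (T : finType) (f : T -> C) : R := \sum_t nsq (f t).

Lemma nsqE z : real_complex R (nsq z) = `|z| ^+ 2.
Proof. exact: add_Re2_Im2. Qed.

Lemma nsq_ge0 z : 0 <= nsq z.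
Proof. by rewrite addr_ge0 ?sqr_ge0. Qed.

Lemma nsqM y z : nsq (y * z) = nsq y * nsq z.
Proof. by apply: (@complexI R); rewrite rmorphM /= !nsqE normrM exprMn. Qed.

Lemma nsq_eq0 z : nsq z = 0 -> z = 0.
Proof.
move/(congr1 (real_complex R)); rewrite nsqE rmorph0 => /eqP.
by rewrite expf_eq0 normr_eq0 => /eqP.
Qed.

Lemma sqnE (T : finType) (f : T -> C) : real_complex R (sqn f) = \sum_t `|f t| ^+ 2.
Proof. by rewrite rmorph_sum /=; apply: eq_bigr => t _; rewrite nsqE. Qed.

Lemma sqn_ge0 (T : finType) (f : T -> C) : 0 <= sqn f.
Proof. by apply: sumr_ge0 => t _; apply: nsq_ge0. Qed.

Lemma eq_sqn (T : finType) (f g : T -> C) : f =1 g -> sqn f = sqn g.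
Proof. by move=> fg; apply: eq_bigr => t _; rewrite fg. Qed.

Lemma sqn_scale (T : finType) (a : C) (f : T -> C) : sqn (fun t => a * f t) = nsq a * sqn f.
Proof. by rewrite mulr_sumr; apply: eq_bigr => t _; rewrite nsqM. Qed.

(** The right side exceeds the left by the squared modulus of [s y - z], divided by [s]. *)
Lemma nsqD_le (s : R) (y z : C) : 0 < s -> nsq (y + z) <= (1 + s) * nsq y + (1 + s^-1) * nsq z.
Proof.
move=> s0; rewrite -subr_ge0 /nsq; case: y => a b; case: z => c d /=.
have -> : (1 + s) * (a ^+ 2 + b ^+ 2) + (1 + s^-1) * (c ^+ 2 + d ^+ 2) -
    ((a + c) ^+ 2 + (b + d) ^+ 2) = ((s * a - c) ^+ 2 + (s * b - d) ^+ 2) / s.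
  by field; rewrite gt_eqF.
by apply: divr_ge0; [rewrite addr_ge0 ?sqr_ge0 | exact: ltW].
Qed.

(** Minkowski's inequality without square roots: sum [nsqD_le] with the weight [B / A], which turns
    the bound into exactly [(A + B) ^+ 2]. The weight must be positive, so vanishing [A] or [B] is
    treated first. *)
Lemma sqn_triangle (T : finType) (f g : T -> C) (A B : R) : 0 <= A -> 0 <= B ->
  sqn f <= A ^+ 2 -> sqn g <= B ^+ 2 -> sqn (fun t => f t + g t) <= (A + B) ^+ 2.
Proof.
have zero (h : T -> C) : sqn h <= 0 ^+ 2 -> h =1 fun=> 0.
  rewrite expr0n /= => h0 t; apply: nsq_eq0; apply/eqP.
  rewrite eq_le nsq_ge0 andbT; apply: le_trans h0.
  by rewrite /sqn (bigD1 t) //= lerDl sumr_ge0 // => *; apply: nsq_ge0.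
rewrite le0r => /orP[/eqP-> | A0] B0.
  move=> /zero f0 gB; rewrite add0r; apply: le_trans gB.
  by rewrite (@eq_sqn _ _ g) // => t; rewrite f0 add0r.
move: B0; rewrite le0r => /orP[/eqP-> | B0].
  move=> fA /zero g0; rewrite addr0; apply: le_trans fA.
  by rewrite (@eq_sqn _ _ f) // => t; rewrite g0 addr0.
move=> fA gB.
have s0 : 0 < B / A by rewrite divr_gt0.
have le1 : sqn (fun t => f t + g t) <= (1 + B / A) * sqn f + (1 + (B / A)^-1) * sqn g.
  rewrite !mulr_sumr -big_split; apply: ler_sum => t _; exact: nsqD_le.
apply: le_trans le1 _.
have -> : (A + B) ^+ 2 = (1 + B / A) * A ^+ 2 + (1 + (B / A)^-1) * B ^+ 2.
  by field; rewrite !gt_eqF.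
by rewrite lerD // ler_wpM2l // addr_ge0 ?invr_ge0 ?ltW.
Qed.

Lemma vnorm_le N (psi : state R N) (e : R) : 0 <= e ->
  (vnorm psi <= real_complex R e) = (sqn psi <= e ^+ 2).
Proof.
move=> e0; rewrite -lecR sqnE rmorphXn /= /vnorm.
set S := \sum_b _; have S0 : 0 <= S by apply: sumr_ge0 => b _; rewrite exprn_ge0.
by rewrite -[S in RHS]sqrtCK ler_pXn2r // nnegrE ?sqrtC_ge0 // ler0c.
Qed.

Lemma isometry_norm (T : finType) (W : T -> T -> C) (v : T -> C) :
  (forall s t, \sum_r W r s * Num.conj (W r t) = (s == t)%:R) ->
  \sum_r `|\sum_s W r s * v s| ^+ 2 = \sum_s `|v s| ^+ 2.
Proof.
move=> WW; transitivity (\sum_s \sum_t v s * Num.conj (v t) * (s == t)%:R).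
  under eq_bigr => r _ do rewrite normCK rmorph_sum mulr_suml.
  rewrite exchange_big; apply: eq_bigr => s _.
  under eq_bigr => r _ do rewrite mulr_sumr.
  rewrite exchange_big; apply: eq_bigr => t _ /=.
  rewrite -WW mulr_sumr; apply: eq_bigr => r _; rewrite rmorphM /=; ring.
apply: eq_bigr => s _; rewrite (bigD1 s) //= eqxx mulr1 big1 => [|t nst].
  by rewrite addr0 normCK.
by rewrite eq_sym (negbTE nst) mulr0.
Qed.

Lemma unitary4_norm (U : 'M[C]_4) (v : 'I_4 -> C) : unitary4 U ->
  \sum_r `|\sum_s U r s * v s| ^+ 2 = \sum_s `|v s| ^+ 2.
Proof.
(* [unitary4] states that the rows are orthonormal; [mulmx1C] passes to the columns. *)
move=> /eqP/mulmx1C/matrixP UU; apply: isometry_norm => s t.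
have := UU t s; rewrite !mxE eq_sym => <-; apply: eq_bigr => r _.
by rewrite !mxE mulrC.
Qed.

(** The four settings of the two bits of the gate group the amplitudes into quadruples on which [U]
    acts as an isometry; letting [b] range over all assignments counts each amplitude four times. *)
Lemma sqn_apply_gate N (g : gate R N) (psi : state R N) :
  gate_wf g -> sqn (apply_gate g psi) = sqn psi.
Proof.
case: g => -[U i] j /andP[Uu nij]; apply: (@complexI R); rewrite !sqnE.
pose put (b : {ffun 'I_N -> bool}) r := setbits b i (hi4 r) j (lo4 r).
pose get (b : {ffun 'I_N -> bool}) := idx2 (b i) (b j).
have put_i b r : put b r i = hi4 r by rewrite ffunE eqxx.
have put_j b r : put b r j = lo4 r by rewrite ffunE eq_sym (negbTE nij) eqxx.
have getK b r : get (put b r) = r by rewrite /get put_i put_j idx2K.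
have put2 b r s : put (put b r) s = put b s.
  by apply/ffunP => k; rewrite !ffunE; case: eqP => //; case: eqP.
have putK b r : put (put b r) (get b) = b.
  rewrite put2; apply/ffunP => k; rewrite !ffunE hi4_idx2 lo4_idx2.
  by case: eqP => [->|] //; case: eqP => [->|].
apply: (@mulIf _ (#|'I_4|%:R)); first by rewrite card_ord pnatr_eq0.
rewrite !mulr_natr -!(sum_resample _ getK putK).
apply: eq_bigr => b _; rewrite -(unitary4_norm (fun r => psi (put b r)) Uu).
apply: eq_bigr => r _; congr (`|_| ^+ 2); rewrite ffunE sum_idx2.
apply: eq_bigr => x _; apply: eq_bigr => y _.
have e b' : setbits b' i x j y = put b' (idx2 x y) by rewrite /put hi4_idx2 lo4_idx2.
by rewrite -/(get _) getK e put2.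
Qed.

Lemma sqn_run N (c : circuit R N) (psi : state R N) :
  circuit_wf c -> sqn (run c psi) = sqn psi.
Proof.
elim: c psi => //= g c IHc psi /andP[gw cw].
by rewrite IHc // sqn_apply_gate.
Qed.

End Norms.

(** * Boolean circuits and reversible computation *)

Section Wires.
Variable X : finType.
Local Notation wire := {ffun X -> bool}.
Implicit Types (L E P Q : seq wire) (u v w : wire).

Definition op2 (g : bool -> bool -> bool) u v : wire := [ffun x => g (u x) (v x)].
Definition wire0 : wire := [ffun=> false].

(** A straight-line program over the inputs [L]. A wire is its truth table on the index set [X], so
    correctness of a program is an equality of functions. *)
Fixpoint chain L E : Prop :=
  if E is w :: E' then
    (exists g u v, [/\ u \in L, v \in L & w = op2 g u v]) /\ chain (rcons L w) E'
  else True.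

Lemma chain_cat L E F : chain L E -> chain (L ++ E) F -> chain L (E ++ F).
Proof.
elim: E L => [|w E IHE] L /=; first by rewrite cats0.
by move=> [wL cE] cF; split=> //; apply: IHE; rewrite // cat_rcons.
Qed.

Lemma chain_sub L L' E : {subset L <= L'} -> chain L E -> chain L' E.
Proof.
elim: E L L' => //= w E IHE L L' sLL' [[g [u [v [uL vL ->]]]] cE]; split.
  by exists g, u, v; split; rewrite ?sLL'.
apply: IHE cE => z; rewrite !mem_rcons !inE => /orP[->//|/sLL'->].
by rewrite orbT.
Qed.

Definition derivable L k P : Prop :=
  exists E, [/\ (size E <= k)%N, chain L E & {subset P <= L ++ E}].

Lemma derivable_weaken L L' k k' P P' : {subset L <= L'} -> (k <= k')%N ->
  {subset P' <= P} -> derivable L k P -> derivable L' k' P'.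
Proof.
move=> sL le_k sP [E [sE cE PE]]; exists E; split.
- exact: leq_trans sE le_k.
- exact: chain_sub sL cE.
move=> w /sP/PE; rewrite !mem_cat => /orP[/sL->//|->]; exact: orbT.
Qed.

Lemma derivable_cat L k P k' Q :
  derivable L k P -> derivable (L ++ P) k' Q -> derivable L (k + k') (P ++ Q).
Proof.
move=> [E [sE cE PE]] [F [sF cF QF]]; exists (E ++ F).
have sP : {subset L ++ P <= L ++ E}.
  by move=> w; rewrite mem_cat => /orP[wL|/PE//]; rewrite mem_cat wL.
split; first by rewrite size_cat leq_add.
  by apply: chain_cat cE _; apply: chain_sub cF.
move=> w; rewrite mem_cat => /orP[/PE|/QF].
  by rewrite !mem_cat => /orP[]->; rewrite ?orbT.
by rewrite catA !(mem_cat _ _ F) => /orP[/sP->|->]; rewrite ?orbT.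
Qed.

Lemma derivable_trans L k P k' Q :
  derivable L k P -> derivable (L ++ P) k' Q -> derivable L (k + k') Q.
Proof.
move=> dP dQ; have := derivable_cat dP dQ; apply: derivable_weaken => // w wQ.
by rewrite mem_cat wQ orbT.
Qed.

Lemma derivable_refl L k P : {subset P <= L} -> derivable L k P.
Proof. by move=> sP; exists [::]; split; rewrite // cats0. Qed.

Lemma derivable_op L g u v : u \in L -> v \in L -> derivable L 1 [:: op2 g u v].
Proof.
move=> uL vL; exists [:: op2 g u v]; split=> //=; first by split=> //; exists g, u, v.
by move=> w; rewrite inE mem_cat inE => ->; rewrite orbT.
Qed.

Lemma derivable_map (T : eqType) L k (s : seq T) (F : T -> wire) :
  (forall t, t \in s -> derivable L k [:: F t]) -> derivable L (size s * k) (map F s).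
Proof.
elim: s => [|t s IHs] dF /=; first exact: derivable_refl.
rewrite mulSn -cat1s; apply: derivable_cat; first by apply: dF; rewrite mem_head.
have /derivable_weaken : derivable L (size s * k) (map F s).
  by apply: IHs => t' ts; apply: dF; rewrite inE ts orbT.
by apply=> // w wL; rewrite mem_cat wL.
Qed.

Lemma derivable_flatten (T : eqType) L k (s : seq T) (F : T -> seq wire) :
  (forall t, t \in s -> derivable L k (F t)) ->
  derivable L (size s * k) (flatten (map F s)).
Proof.
elim: s => [|t s IHs] dF /=; first exact: derivable_refl.
rewrite mulSn; apply: derivable_cat; first by apply: dF; rewrite mem_head.
have /derivable_weaken : derivable L (size s * k) (flatten (map F s)).
  by apply: IHs => t' ts; apply: dF; rewrite inE ts orbT.
by apply=> // w wL; rewrite mem_cat wL.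
Qed.

Definition mux c u v : wire := [ffun x => if c x then u x else v x].

Lemma derivable_mux L c u v : c \in L -> u \in L -> v \in L -> derivable L 3 [:: mux c u v].
Proof.
move=> cL uL vL; have d1 := derivable_op andb cL uL.
have d2 : derivable (L ++ [:: op2 andb c u]) 1 [:: op2 (fun a b => ~~ a && b) c v].
  by apply: derivable_op; rewrite mem_cat ?cL ?vL.
have := derivable_cat d1 d2 => d12; apply: (derivable_trans d12).
have -> : mux c u v = op2 orb (op2 andb c u) (op2 (fun a b => ~~ a && b) c v).
  by apply/ffunP => x; rewrite !ffunE; case: (c x); rewrite /= ?orbF.
by apply: derivable_op; rewrite mem_cat !inE eqxx ?orbT.
Qed.

End Wires.

(** * Simulating straight-line programs by quantum circuits *)

Section Reach.
Variables (R : realType) (N : nat) (X : finType).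
Local Notation wire := {ffun X -> bool}.
Local Notation bits := {ffun 'I_N -> bool}.
Implicit Types (kap : X -> bits) (L E : seq wire) (i u v : 'I_N).

(** The default [wire0] makes all qubits past the end of the list clean ancillas. *)
Definition conf L (x : X) : bits := [ffun k : 'I_N => nth (wire0 X) L k x].

(** One circuit serves all [x], so that by linearity it also acts correctly on superpositions. *)
Definition reach (k : nat) kap kap' : Prop :=
  exists c : circuit R N, [/\ circuit_wf c, (size c <= k)%N &
    forall x, run c (ket R (kap x)) = ket R (kap' x)].

Lemma reach_refl k kap : reach k kap kap.
Proof. by exists [::]. Qed.

Lemma reach_trans k k' kap1 kap2 kap3 :
  reach k kap1 kap2 -> reach k' kap2 kap3 -> reach (k + k') kap1 kap3.
Proof.
move=> [c [cw sc cE]] [c' [cw' sc' cE']]; exists (c ++ c').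
by rewrite circuit_wf_cat cw cw' size_cat leq_add //; split=> // x; rewrite run_cat cE cE'.
Qed.

Lemma reach_weaken k k' kap1 kap2 kap1' kap2' : (k <= k')%N ->
  kap1 =1 kap1' -> kap2 =1 kap2' -> reach k kap1 kap2 -> reach k' kap1' kap2'.
Proof.
move=> lek e1 e2 [c [cw sc cE]]; exists c; split=> //; first exact: leq_trans lek.
by move=> x; rewrite -e1 -e2.
Qed.

Lemma flipD (b : bits) i x y : flip (flip b i x) i y = flip b i (x (+) y).
Proof. by rewrite /flip setbit2 ffunE eqxx addbA. Qed.

Lemma flip_neq (b : bits) i x k : k != i -> flip b i x k = b k.
Proof. by move=> nki; rewrite ffunE (negbTE nki). Qed.

Lemma reach_xor h u i kap : u != i ->
  reach 1 kap (fun x => flip (kap x) i (h (kap x u))).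
Proof.
move=> nui; exists [:: xor_gate R h u i].
split=> // [|x]; first by rewrite /circuit_wf /= xor_gate_wf.
apply: (@run_ket R N _ (fun b => flip b i (h (b u))) (kap x)) => [b|psi b].
  by rewrite flip_neq // flip2.
exact: xor_gateE.
Qed.

Lemma reach_toffoli u v i kap : u != v -> u != i -> v != i ->
  reach 7 kap (fun x => flip (kap x) i (kap x u && kap x v)).
Proof.
move=> nuv nui nvi; exists (toffoli R u v i); rewrite toffoli_wf //; split=> // x.
apply: (@run_ket R N _ (fun b => flip b i (b u && b v)) (kap x)) => [b|psi b].
  by rewrite !flip_neq // flip2.
exact: toffoliE.
Qed.

(* Every two-input Boolean function is a xor of a function of [u], a function
   of [v] and possibly [u && v]. *)
Lemma reach_op g u v i kap : u != i -> v != i ->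
  reach 9 kap (fun x => flip (kap x) i (g (kap x u) (kap x v))).
Proof.
(* A Toffoli gate needs distinct controls; for equal ones a single [xor_gate] suffices. *)
move=> nui nvi; have [<-|nuv] := eqVneq u v.
  by apply: reach_weaken (reach_xor (fun a => g a a) _ nui).
pose h1 a := g a false; pose h2 b := g false b (+) g false false.
have r1 := reach_xor h1 kap nui; have := reach_xor h2 _ nvi => r2.
have := reach_trans r1 (r2 _) => {r1 r2} r12.
(* The sum tested is the coefficient of [u && v] in the algebraic normal form of [g]. If it is 1, a
   Toffoli of 7 gates joins the two xor gates, which gives the bound 9. *)
have [c3|c3] := boolP (g true true (+) g true false (+) g false true (+) g false false).
  have r3 := reach_trans r12 (reach_toffoli _ nuv nui nvi).
  apply: reach_weaken r3 => // x.
  rewrite !flip_neq // !flipD; congr flip; rewrite /h1 /h2; move: c3.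
  by case: (kap x u); case: (kap x v); case: (g true true); case: (g true false);
    case: (g false true); case: (g false false).
apply: reach_weaken r12 => // x.
rewrite !flip_neq // !flipD; congr flip; rewrite /h1 /h2; move: c3.
by case: (kap x u); case: (kap x v); case: (g true true); case: (g true false);
  case: (g false true); case: (g false false).
Qed.

(** Keeping both directions is what allows scratch wires to be erased by running their computation
    backwards. *)
Definition bireach k kap kap' := reach k kap kap' /\ reach k kap' kap.

Lemma bireach_refl k kap kap' : kap =1 kap' -> bireach k kap kap'.
Proof.
by move=> e; split; [apply: reach_weaken (reach_refl k kap)
  | apply: reach_weaken (reach_refl k kap)].
Qed.

Lemma bireach_trans k k' kap1 kap2 kap3 :
  bireach k kap1 kap2 -> bireach k' kap2 kap3 -> bireach (k + k') kap1 kap3.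
Proof.
move=> [r1 r1'] [r2 r2']; split; first exact: reach_trans r1 r2.
by rewrite addnC; apply: reach_trans r2' r1'.
Qed.

(** The flip leaves its controls unchanged, so the same operation undoes it. *)
Lemma bireach_op g u v i kap kap' : u != i -> v != i ->
  (forall x, kap' x = flip (kap x) i (g (kap x u) (kap x v))) -> bireach 9 kap kap'.
Proof.
move=> nui nvi e; split; first by apply: reach_weaken (reach_op g kap nui nvi) => // x.
apply: reach_weaken (reach_op g kap' nui nvi) => // x.
by rewrite e !flip_neq // flip2.
Qed.

Lemma nth_around (T : eqType) (x0 a w : T) (L1 L2 : seq T) : w \in L1 ++ L2 ->
  exists k, [/\ k != size L1, (k < size (L1 ++ a :: L2))%N & nth x0 (L1 ++ a :: L2) k = w].
Proof.
rewrite mem_cat size_cat => /orP[wL|wL].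
  exists (index w L1); rewrite nth_cat index_mem wL nth_index //.
  have lt := wL; rewrite -index_mem in lt.
  by split=> //; [rewrite ltn_eqF | rewrite ltn_addr].
exists (size L1 + (index w L2).+1)%N; rewrite nth_cat (ltnNge _ (size L1)) leq_addr addKn /= nth_index //.
by split=> //; [lia | rewrite ltn_add2l ltnS index_mem].
Qed.

Lemma bireach_wire g L1 (a u v : wire) L2 :
  u \in L1 ++ L2 -> v \in L1 ++ L2 -> (size (L1 ++ a :: L2) <= N)%N ->
  bireach 9 (conf (L1 ++ a :: L2)) (conf (L1 ++ op2 addb a (op2 g u v) :: L2)).
Proof.
move=> /(nth_around (wire0 X) a)[ku [nu lu eu]] /(nth_around (wire0 X) a)[kv [nv lv ev]] sN.
have li : (size L1 < N)%N by apply: leq_trans sN; rewrite size_cat /= -addSnnS leq_addr.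
pose i := Ordinal li; pose u' := Ordinal (leq_trans lu sN); pose v' := Ordinal (leq_trans lv sN).
apply: (@bireach_op g u' v' i) => // x; apply/ffunP => k; rewrite !ffunE /= eu ev -val_eqE /=.
rewrite !nth_cat; case: eqP => [->|/eqP nk].
  by rewrite ltnn subnn /= !ffunE.
case: ltnP => // le_k; have: (k - size L1)%N != 0%N by rewrite subn_eq0 -ltnNge ltn_neqAle eq_sym nk.
by case: (k - size L1)%N.
Qed.

Lemma conf_cat0 L s : conf (L ++ nseq s (wire0 X)) =1 conf L.
Proof.
move=> x; apply/ffunP => k; rewrite !ffunE nth_cat nth_nseq.
by case: ltnP => // le_k; rewrite (nth_default _ le_k) if_same.
Qed.

Lemma op20b (w : wire) : op2 addb (wire0 X) w = w.
Proof. by apply/ffunP => x; rewrite !ffunE. Qed.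

(** Each new wire is xored into the next qubit, which still holds 0. *)
Lemma bireach_chain L E : chain L E -> (size (L ++ E) <= N)%N ->
  bireach (9 * size E) (conf L) (conf (L ++ E)).
Proof.
elim: E L => [|w E IHE] L /=; first by rewrite cats0 => *; apply: bireach_refl.
move=> [[g [u [v [uL vL ->]]]] cE]; rewrite -cat_rcons => sN; rewrite mulnS.
apply: bireach_trans (IHE _ cE sN).
have sN' : (size (L ++ [:: wire0 X]) <= N)%N.
  by apply: leq_trans sN; rewrite !size_cat size_rcons addn1 leq_addr.
have := @bireach_wire g L (wire0 X) u v [::]; rewrite cats0 op20b => /(_ uL vL sN').
by case=> r r'; split; [apply: reach_weaken r | apply: reach_weaken r'] => // x;
  rewrite ?(conf_cat0 L 1) ?cats1.
Qed.

(** Replace the wires one at a time: xoring [a] with the difference of [a] and [b], available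
    outside the block, yields [b]. With one of the blocks zero, this copies or erases. *)
Lemma bireach_block L1 A B L2 : size A = size B ->
  (forall k, (k < size A)%N -> op2 addb (nth (wire0 X) A k) (nth (wire0 X) B k) \in L1 ++ L2) ->
  (size (L1 ++ A ++ L2) <= N)%N ->
  bireach (9 * size A) (conf (L1 ++ A ++ L2)) (conf (L1 ++ B ++ L2)).
Proof.
elim: A B L1 => [|a A IHA] [|b B] L1 //= => [_ _ _|[sAB] AB sN].
  exact: bireach_refl.
rewrite mulnS; apply: (@bireach_trans _ _ _ (conf (L1 ++ b :: A ++ L2))); last first.
  rewrite -!cat_rcons; apply: IHA => // [k lt_k|].
    have := AB k.+1 lt_k; rewrite /= !mem_cat mem_rcons inE => /orP[]->; by rewrite ?orbT.
  by move: sN; rewrite !size_cat /= size_rcons ?size_cat; lia.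
have ab : op2 addb a b \in L1 ++ (A ++ L2).
  have := AB 0%N isT; rewrite /= !mem_cat => /orP[]->; by rewrite ?orbT.
(* The difference wire is given as both operands, and the projection keeps just one of them. *)
have := bireach_wire (fun x (_ : bool) => x) ab ab sN.
rewrite (_ : op2 addb a _ = b) //; apply/ffunP => x; rewrite !ffunE.
by rewrite addbA addbb.
Qed.

(* The states are I,0 -> I,O -> 0,O -> O,O -> O,0; the intermediate wires of each
   derivation are erased again by running it backwards. *)
Lemma reach_derivable (I O : seq wire) k k' (s := size I) : size O = s ->
  derivable I k O -> derivable O k' I -> (s + s + k + k' <= N)%N ->
  reach (9 * (2 * k + 2 * k' + 4 * s)) (conf I) (conf O).
Proof.
move=> sO [E [sE cE OE]] [E' [sE' cE' IE']] sN.
pose Z := nseq s (wire0 X).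
have sZ : size Z = s by rewrite size_nseq.
have subl (A B C : seq wire) : {subset A <= B} -> {subset A <= B ++ C}.
  by move=> AB w /AB wB; rewrite mem_cat wB.
have subr (A B C : seq wire) : {subset A <= B} -> {subset A <= C ++ B}.
  by move=> AB w /AB wB; rewrite mem_cat wB orbT.
have opZ (w : wire) (i : nat) : op2 addb w (nth (wire0 X) Z i) = w.
  by rewrite nth_nseq if_same; apply/ffunP => x; rewrite !ffunE addbF.
have opZ' (w : wire) (i : nat) : op2 addb (nth (wire0 X) Z i) w = w.
  by rewrite nth_nseq if_same op20b.
(* Compute the scratch wires [E] behind a zero block [Z] reserved for [O], copy [O] into that block,
   then erase [E]. *)
have r1 : bireach (9 * k) (conf (I ++ Z)) (conf ((I ++ Z) ++ E)).
  have [|r r'] := @bireach_chain (I ++ Z) E (chain_sub (subl _ _ _ (fun _ => id)) cE).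
    by rewrite !size_cat -/s sZ; lia.
  by split; [apply: reach_weaken r | apply: reach_weaken r'] => //; lia.
have r2 : bireach (9 * s) (conf (I ++ Z ++ E)) (conf (I ++ O ++ E)).
  rewrite -sZ; apply: bireach_block => [|i|]; rewrite ?sZ ?sO //; first move=> lt_i.
    by rewrite opZ'; apply: OE; rewrite mem_nth ?sO.
  by rewrite !size_cat -/s sZ; lia.
have r3 : bireach (9 * k) (conf ((I ++ O) ++ E)) (conf (I ++ O)).
  have [|r r'] := @bireach_chain (I ++ O) E (chain_sub (subl _ _ _ (fun _ => id)) cE).
    by rewrite !size_cat -/s sO; lia.
  by split; [apply: reach_weaken r' | apply: reach_weaken r] => //; lia.
(* Now [I] is recomputed from [O] among the wires [E'], the original [I] is cancelled against this
   second copy, and [E'] is erased. *)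
have r4 : bireach (9 * k') (conf (I ++ O)) (conf ((I ++ O) ++ E')).
  have [|r r'] := @bireach_chain (I ++ O) E' (chain_sub (subr _ _ _ (fun _ => id)) cE').
    by rewrite !size_cat -/s sO; lia.
  by split; [apply: reach_weaken r | apply: reach_weaken r'] => //; lia.
have r5 : bireach (9 * s) (conf ([::] ++ I ++ (O ++ E'))) (conf ([::] ++ Z ++ (O ++ E'))).
  apply: bireach_block => [|i lt_i|]; rewrite ?sZ //.
    by rewrite opZ; apply: IE'; rewrite mem_nth.
  by rewrite !size_cat -/s sO /=; lia.
have r6 : bireach (9 * k') (conf ((Z ++ O) ++ E')) (conf (Z ++ O)).
  have [|r r'] := @bireach_chain (Z ++ O) E' (chain_sub (subr _ _ _ (fun _ => id)) cE').
    by rewrite !size_cat sZ sO; lia.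
  by split; [apply: reach_weaken r' | apply: reach_weaken r] => //; lia.
(* Moving [O] to the front is a copy followed by erasing the old block against the new one. *)
have r7 : bireach (9 * s) (conf ([::] ++ Z ++ O)) (conf ([::] ++ O ++ O)).
  rewrite -sZ; apply: bireach_block => [|i|]; rewrite ?sZ ?sO //; first move=> lt_i.
    by rewrite opZ' mem_nth ?sO.
  by rewrite !size_cat sZ sO /=; lia.
have r8 : bireach (9 * s) (conf (O ++ O ++ [::])) (conf (O ++ Z ++ [::])).
  rewrite -sO; apply: bireach_block => [|i|]; rewrite ?sZ ?sO //; first move=> lt_i.
    by rewrite opZ cats0 mem_nth ?sO.
  by rewrite !size_cat sO /=; lia.
rewrite /= !cats0 -?catA in r1 r2 r3 r4 r5 r6 r7 r8.
have [r _] := bireach_trans r1 (bireach_trans r2 (bireach_trans r3 (bireach_trans r4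
  (bireach_trans r5 (bireach_trans r6 (bireach_trans r7 r8)))))).
by apply: reach_weaken r; [lia | apply: conf_cat0 | apply: conf_cat0].
Qed.

End Reach.

(** * Arithmetic modulo p *)

Section Arithmetic.
Variable X : finType.
Local Notation wire := {ffun X -> bool}.
Implicit Types (L : seq wire) (a : X -> nat).

Definition bitw a i : wire := [ffun x => odd (a x %/ 2 ^ i)].
Definition bitsw m a : seq wire := [seq bitw a i | i <- iota 0 m].
(** A closed form for the carry into position [i]; the ripple recurrence then becomes a lemma. *)
Definition carryw a K i : wire := [ffun x => (2 ^ i <= a x %% 2 ^ i + K %% 2 ^ i)%N].

Lemma modn_exp2S b i : (b %% 2 ^ i.+1 = b %% 2 ^ i + 2 ^ i * odd (b %/ 2 ^ i))%N.
Proof.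
have e := divn_eq b (2 ^ i); have lt_b : (b %% 2 ^ i < 2 ^ i)%N by rewrite ltn_mod expn_gt0.
rewrite {1}e -{1}[(b %/ 2 ^ i)%N]odd_double_half -muln2 mulnDl.
have -> : (odd (b %/ 2 ^ i) * 2 ^ i + (b %/ 2 ^ i)./2 * 2 * 2 ^ i + b %% 2 ^ i =
   (b %/ 2 ^ i)./2 * 2 ^ i.+1 + (b %% 2 ^ i + 2 ^ i * odd (b %/ 2 ^ i)))%N.
  by rewrite expnS; ring.
rewrite modnMDl modn_small // expnS; case: odd; lia.
Qed.

(** The next carry is the majority of two bits and the old carry. As the bit of [K] is a constant,
    the majority collapses to a disjunction or a conjunction. *)
Lemma carrywS a K i : carryw a K i.+1 =
  op2 (fun u c => if odd (K %/ 2 ^ i) then u || c else u && c) (bitw a i) (carryw a K i).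
Proof.
apply/ffunP => x; rewrite !ffunE !modn_exp2S expnS.
have := ltn_pmod (a x) (expn_gt0 2 i); have := ltn_pmod K (expn_gt0 2 i).
case: odd; case: odd; case: leqP; lia.
Qed.

Lemma bitwD a K i : bitw (fun x => a x + K)%N i =
  op2 (fun u c => u (+) odd (K %/ 2 ^ i) (+) c) (bitw a i) (carryw a K i).
Proof. by apply/ffunP => x; rewrite !ffunE divnD ?expn_gt0 // !oddD oddb. Qed.

Lemma eq_bitw a a' i : a =1 a' -> bitw a i = bitw a' i.
Proof. by move=> e; apply/ffunP => x; rewrite !ffunE e. Qed.

Lemma eq_bitsw m a a' : a =1 a' -> bitsw m a = bitsw m a'.
Proof. by move=> e; apply: eq_map => i; apply: eq_bitw. Qed.

Lemma mem_bitsw m a i : (i < m)%N -> bitw a i \in bitsw m a.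
Proof. by move=> lt_i; apply: map_f; rewrite mem_iota. Qed.

Lemma derivable_carry L m a K : L != [::] -> {subset bitsw m a <= L} ->
  derivable L m.+1 [seq carryw a K i | i <- iota 0 m.+1].
Proof.
move=> L0; elim: m => [|m IHm] sL.
  (* The carry into position 0 is constantly false, and a constant has to be produced from some wire
     of [L]. *)
  case: L L0 {sL} => // w L _; have := derivable_op (fun _ _ => false) (mem_head w L) (mem_head w L).
  apply: derivable_weaken => // z; rewrite !inE => /eqP->; apply/eqP/ffunP => x.
  by rewrite !ffunE !modn1.
have -> : [seq carryw a K i | i <- iota 0 m.+2] =
    [seq carryw a K i | i <- iota 0 m.+1] ++ [:: carryw a K m.+1].
  by rewrite -[m.+2]addn1 iotaD map_cat.
rewrite -[m.+2]addn1.
apply: derivable_cat.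
  by apply: IHm => w /mapP[i lt_i ->]; apply: sL; apply: mem_bitsw; rewrite mem_iota in lt_i; lia.
rewrite carrywS; apply: derivable_op; rewrite mem_cat.
  by rewrite sL // mem_bitsw.
by rewrite map_f ?orbT // mem_iota; lia.
Qed.

Lemma derivable_add L m a K : L != [::] -> {subset bitsw m a <= L} ->
  derivable L (m.+1 + m) (carryw a K m :: bitsw m (fun x => a x + K)%N).
Proof.
move=> L0 sL; have d1 := derivable_carry K L0 sL.
have := @derivable_map _ _ (L ++ [seq carryw a K i | i <- iota 0 m.+1]) 1 (iota 0 m)
  (bitw (fun x => a x + K)%N).
rewrite size_iota muln1 => d2.
have /(derivable_cat d1) : derivable (L ++ [seq carryw a K i | i <- iota 0 m.+1]) m
    (bitsw m (fun x => a x + K)%N).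
  apply: d2 => i; rewrite mem_iota => /andP[_ lt_i]; rewrite bitwD.
  apply: derivable_op; rewrite mem_cat; first by rewrite sL ?mem_bitsw.
  by rewrite map_f ?orbT // mem_iota; lia.
have mc : carryw a K m \in [seq carryw a K i | i <- iota 0 m.+1].
  by apply: map_f; rewrite mem_iota; lia.
apply: derivable_weaken => // w; rewrite in_cons (mem_cat w) => /orP[/eqP->|->].
  by rewrite mc.
by rewrite orbT.
Qed.

(* Both [a + K] and [a + K - p] (as [a + (K + 2 ^ m - p)] modulo [2 ^ m]) are
   computed; the carry of the second one tells which is the reduced sum. *)
Lemma derivable_modadd L m p a (c : wire) K : (p <= 2 ^ m)%N -> (K < p)%N ->
  (forall x, (a x < p)%N) -> c \in L -> {subset bitsw m a <= L} ->
  derivable L (10 * m + 2) (bitsw m (fun x => (a x + c x * K) %% p)%N).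
Proof.
move=> le_p lt_K lt_a cL sL; pose K' := (K + (2 ^ m - p))%N.
have L0 : L != [::] by case: L cL {sL}.
have d1 := derivable_add K L0 sL.
have d2 : derivable (L ++ (carryw a K m :: bitsw m (fun x => a x + K)%N)) (m.+1 + m)
    (carryw a K' m :: bitsw m (fun x => a x + K')%N).
  by apply: derivable_add => [|w /sL wL]; [case: L L0 {sL cL d1} | rewrite mem_cat wL].
have := derivable_cat d1 d2; set P1 := _ ++ _ => d12.
(* Per bit, [sel] chooses between the two sums and [res] keeps [a] when [c] is off. These are 6
   operations per bit, besides [2 * (2 * m + 1)] for the two additions. *)
pose sel i := mux (carryw a K' m) (bitw (fun x => a x + K')%N i) (bitw (fun x => a x + K)%N i).
pose res i := mux c (sel i) (bitw a i).
have d3 : derivable (L ++ P1) (m * 6) (map res (iota 0 m)).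
  rewrite -[m in (m * 6)%N](size_iota 0) ; apply: derivable_map => i; rewrite mem_iota /= => lt_i.
  rewrite -[6%N]/(3 + 3)%N; apply: (@derivable_trans _ _ 3 [:: sel i]).
    apply: derivable_mux; rewrite mem_cat /P1 mem_cat !inE ?eqxx ?mem_bitsw ?orbT //.
  have aL := sL _ (mem_bitsw a lt_i).
  by apply: derivable_mux; rewrite mem_cat ?mem_head ?orbT // mem_cat ?cL ?aL.
have := derivable_trans d12 d3; apply: derivable_weaken => //; first by lia.
move=> w /mapP[i lt_i ->]; rewrite mem_iota /= in lt_i.
have -> : bitw (fun x => (a x + c x * K) %% p)%N i = res i; last by apply: map_f; rewrite mem_iota.
apply/ffunP => x; rewrite !ffunE; have la := lt_a x.
case: (c x); last by rewrite mul0n addn0 modn_small.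
rewrite mul1n (@modn_small (a x)) ?(@modn_small K'); [|by rewrite /K'; lia|by lia].
have -> : (2 ^ m <= a x + K')%N = (p <= a x + K)%N by rewrite /K'; lia.
case: leqP => [le_s|lt_s]; last by rewrite modn_small.
have -> : ((a x + K) %% p = a x + K - p)%N.
  by rewrite -[in LHS](subnK le_s) modnDr modn_small //; lia.
(* In this case [a + K'] exceeds the reduced sum by [2 ^ m], which does not affect bit [i] because
   [i < m]. *)
have -> : (a x + K' = 2 ^ (m - i) * 2 ^ i + (a x + K - p))%N.
  by rewrite -expnD subnK 1?ltnW // /K'; lia.
by rewrite divnMDl ?expn_gt0 // oddD oddX subn_eq0 leqNgt lt_i.
Qed.

End Arithmetic.

(** * Residues, registers and linear maps *)

Section PrimeField.
Variable (p : nat).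
Hypothesis p_pr : prime p.

Lemma ltn_Fp (K : 'F_p) : (K < p)%N.
Proof. by rewrite -[X in (_ < X)%N](Fp_cast p_pr). Qed.

Lemma val_FpD (K K' : 'F_p) : (K + K' : 'F_p) = ((K + K')%N %% p)%N :> nat.
Proof. by rewrite -[X in (_ %% X)%N](Fp_cast p_pr). Qed.

Lemma natr_FpK (K : 'F_p) : (K : nat)%:R = K.
Proof. exact: natr_Zp. Qed.

Lemma le_qubits_per_reg : (p <= 2 ^ qubits_per_reg p)%N.
Proof. exact: up_logP. Qed.

Lemma qubits_per_reg_gt0 : (0 < qubits_per_reg p)%N.
Proof. by rewrite up_log_gt0 (prime_gt1 p_pr). Qed.

End PrimeField.

Lemma reg_index_lt n m (j : 'I_n) i : (i < m)%N -> (j * m + i < n * m)%N.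
Proof. by move=> lt_i; apply: (@leq_trans (j.+1 * m)); rewrite ?leq_mul2r ?ltn_ord ?orbT //; lia. Qed.

Section Registers.
Variables (p : nat) (X : finType).
Hypothesis p_pr : prime p.
Local Notation wire := {ffun X -> bool}.
Local Notation m := (qubits_per_reg p).

(** An accumulator starts at the constant 0, at cost 1, and receives one controlled modular addition
    per term; [10 * m + 2] is at most [12 * m] since [m] is positive. *)
Lemma derivable_lincomb (L : seq wire) (ts : seq (wire * 'F_p)) : L != [::] ->
  (forall t, t \in ts -> t.1 \in L) ->
  derivable L (size ts * (12 * m) + 1)
    (bitsw m (fun x => \sum_(t <- ts) (t.1 x)%:R * t.2 : 'F_p)).
Proof.
move=> L0; have m_gt0 : (0 < m)%N by exact: qubits_per_reg_gt0.
elim: ts => [|t ts IHts] tsL.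
  case: L L0 {tsL} => // w L _.
  have := derivable_op (fun _ _ => false) (mem_head w L) (mem_head w L).
  apply: derivable_weaken => // z /mapP[i _ ->]; rewrite inE; apply/eqP/ffunP => x.
  by rewrite !ffunE big_nil div0n.
have dts := IHts (fun t' h => tsL t' (mem_behead (s := t :: ts) h)).
have le_k : (size ts * (12 * m) + 1 + (10 * m + 2) <= size (t :: ts) * (12 * m) + 1)%N.
  by rewrite /= mulSn; lia.
apply: (derivable_weaken (fun _ => id) le_k (fun _ => id)).
apply: (derivable_trans dts).
pose acc x : nat := (\sum_(t <- ts) (t.1 x)%:R * t.2 : 'F_p).
rewrite -/acc.
rewrite [X in derivable _ _ X](@eq_bitsw _ _ _ (fun x => (acc x + t.1 x * t.2) %% p)%N) => [|x]; last first.
  rewrite big_cons addrC val_FpD //; congr ((_ + _) %% p)%N.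
  by case: (t.1 x); rewrite ?mul1r ?mul0r ?mul1n ?mul0n.
apply: derivable_modadd => [|||| w wa]; rewrite ?mem_cat ?wa ?orbT //.
- exact: le_qubits_per_reg.
- exact: ltn_Fp.
- by move=> x; apply: ltn_Fp.
by rewrite tsL ?mem_head.
Qed.

Variable n : nat.
Implicit Types y : X -> 'rV['F_p]_n.

(** The formula repeats the one inside [enc_regs], so that the two match by folding. *)
Definition regbit (z : 'rV['F_p]_n) (k : nat) : bool :=
  odd (\sum_(j < n | (j : nat) == (k %/ m)%N) ((z ord0 j : nat) %/ 2 ^ (k %% m))).

Definition regw y : seq wire := [seq [ffun x => regbit (y x) k] | k <- iota 0 (n * m)].

Lemma size_regw y : size (regw y) = (n * m)%N.
Proof. by rewrite size_map size_iota. Qed.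

Lemma regbitE (z : 'rV['F_p]_n) (j : 'I_n) i : (i < m)%N ->
  regbit z (j * m + i) = odd (z ord0 j %/ 2 ^ i).
Proof.
move=> lt_i; have m0 := leq_ltn_trans (leq0n i) lt_i.
rewrite /regbit divnMDl // modnMDl divn_small // addn0 modn_small //.
by rewrite (big_pred1 j).
Qed.

Lemma mem_regw y (j : 'I_n) i : (i < m)%N -> bitw (fun x => y x ord0 j : nat) i \in regw y.
Proof.
move=> lt_i; apply/mapP; exists (j * m + i)%N; last first.
  by apply/ffunP => x; rewrite !ffunE regbitE.
by rewrite mem_iota reg_index_lt.
Qed.

Lemma regw_sub y : {subset regw y <=
  flatten [seq bitsw m (fun x => y x ord0 j : nat) | j <- enum 'I_n]}.
Proof.
move=> w /mapP[k]; rewrite mem_iota /= add0n => lt_k ->.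
have m0 : (0 < m)%N by case: m lt_k; rewrite ?muln0.
have lt_j : (k %/ m < n)%N by rewrite ltn_divLR.
apply/flatten_mapP; exists (Ordinal lt_j); first by rewrite mem_enum.
apply/mapP; exists (k %% m)%N; first by rewrite mem_iota /= ltn_mod.
apply/ffunP => x; rewrite !ffunE -regbitE ?ltn_mod //=.
by rewrite -divn_eq.
Qed.

Lemma conf_regw N y x : conf N (regw y) x = enc_regs m N (y x).
Proof.
apply/ffunP => k; rewrite !ffunE; case: ltnP => lt_k /=.
  by rewrite (nth_map 0%N) ?size_iota // nth_iota // ffunE.
by rewrite nth_default ?ffunE // size_regw.
Qed.

(** Induction gives the expansion of the [k] low bits, and [m] bits suffice because [p <= 2 ^ m]. *)
Lemma Fp_bits (K : 'F_p) : K = \sum_(i < m) (odd (K %/ 2 ^ i))%:R * 2 ^+ i.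
Proof.
have E k : (K %% 2 ^ k)%N%:R = \sum_(i < k) (odd (K %/ 2 ^ i))%:R * 2 ^+ i :> 'F_p.
  elim: k => [|k IHk]; first by rewrite modn1 big_ord0.
  by rewrite modn_exp2S natrD IHk big_ord_recr /= natrM natrX mulrC.
rewrite -E modn_small ?natr_FpK //.
exact: leq_trans (ltn_Fp p_pr K) (le_qubits_per_reg p).
Qed.

Lemma derivable_mulmx y (A : 'M['F_p]_n) : (0 < n)%N ->
  derivable (regw y) (13 * n ^ 2 * m ^ 2) (regw (fun x => y x *m A)).
Proof.
move=> n0; have m0 : (0 < m)%N by exact: qubits_per_reg_gt0.
(* Coordinate [j] of the product has one term per bit: bit [k] of register [i] controls the constant
   [2 ^+ k * A i j]. *)
pose ts j := [seq (bitw (fun x => y x ord0 ij.1 : nat) ij.2, 2 ^+ ij.2 * A ij.1 j)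
  | ij : 'I_n * 'I_m <- enum {: 'I_n * 'I_m}].
have sz j : size (ts j) = (n * m)%N by rewrite size_map -cardE card_prod !card_ord.
have L0 : regw y != [::] by rewrite -size_eq0 size_regw -lt0n muln_gt0 n0.
(* The additive [n] left over from the zero constants is absorbed by raising 12 to 13. *)
have le_k : (size (enum 'I_n) * (n * m * (12 * m) + 1) <= 13 * n ^ 2 * m ^ 2)%N.
  rewrite size_enum_ord; have : (n * 1 <= n * (n * m * m))%N by rewrite leq_mul2l !muln_gt0 n0 m0 orbT.
  by rewrite -!mulnn; nia.
apply: (derivable_weaken (fun _ => id) le_k (@regw_sub (fun x => y x *m A))).
apply: derivable_flatten => j _.
have := @derivable_lincomb _ (ts j) L0; rewrite sz.
rewrite (@eq_bitsw _ _ _ (fun x => (y x *m A) ord0 j : nat)) => [|x].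
  by apply=> t /mapP[[i k] _ ->]; apply: mem_regw.
rewrite big_map big_enum /= -(pair_bigA _
  (fun i (k : 'I_m) => (bitw (fun x => y x ord0 i : nat) k x)%:R * (2 ^+ k * A i j))) /=.
congr (nat_of_ord _); rewrite mxE; apply: eq_bigr => i _.
rewrite [y x ord0 i]Fp_bits mulr_suml; apply: eq_bigr => k _.
by rewrite ffunE mulrA.
Qed.

(** Apply [reach_derivable] with both derivations of size [13 * n ^ 2 * m ^ 2] and [s = n * m],
    which is at most [n ^ 2 * m ^ 2]. This needs 2 + 26 = 28 units of qubits and 9 * (26 + 26 + 4) =
    504 units of gates. *)
Lemma reach_mulmx (R : realType) N (A : 'M['F_p]_n) y : (0 < n)%N -> A \in unitmx ->
  (28 * n ^ 2 * m ^ 2 <= N)%N ->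
  reach R (504 * n ^ 2 * m ^ 2) (fun x => enc_regs m N (y x))
    (fun x => enc_regs m N (y x *m A)).
Proof.
move=> n0 uA leN; have m0 : (0 < m)%N by exact: qubits_per_reg_gt0.
have d1 := derivable_mulmx y A n0.
have := derivable_mulmx (fun x => y x *m A) (invmx A) n0.
rewrite {2}/regw; under eq_map => k do under eq_ffun => x do rewrite mulmxK //.
rewrite -/(regw y) => d2.
have le_nm : (n * m <= n ^ 2 * m ^ 2)%N by rewrite -expnMn -mulnn leq_pmulr ?muln_gt0 ?n0.
have := @reach_derivable R N X _ _ _ _ _ d1 d2.
rewrite !size_regw => /(_ erefl) r.
apply: reach_weaken (r _) => [|x|x|]; rewrite ?conf_regw //; lia.
Qed.

End Registers.

(** * The Fourier transform modulo p *)

Section FourierRoot.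
Variables (R : realType) (p : nat).
Hypothesis p_pr : prime p.
Local Notation C := R[i].
Local Notation om := (omega R p).

Let p_neq0 : p%:R != 0 :> R.
Proof. by rewrite pnatr_eq0 -lt0n prime_gt0. Qed.

Lemma omegaX k : om ^+ k =
  Complex (cos (k%:R * (2 * pi / p%:R))) (sin (k%:R * (2 * pi / p%:R))).
Proof.
elim: k => [|k IHk]; first by rewrite mul0r cos0 sin0.
rewrite exprSr IHk /omega; set t := (2 * pi / p%:R).
by rewrite -natr1 mulrDl mul1r cosD sinD; congr Complex; rewrite addrC.
Qed.

Lemma omegaXp : om ^+ p = 1.
Proof.
rewrite omegaX mulrCA mulfV // mulr1 mulr_natl cos2pi.
by rewrite sin2pi.
Qed.

(** For [p = 2] the cosine is -1; for larger [p] the angle lies strictly between 0 and pi, so the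
    sine is positive. *)
Lemma omega_neq1 : om != 1.
Proof.
apply/eqP => -[c1 s0].
have [p2|p_neq2] := eqVneq p 2%N.
  by move: c1; rewrite p2 mulrAC mulfV ?pnatr_eq0 // mul1r cospi; lra.
have p3 : 2 < p%:R :> R by rewrite ltr_nat ltn_neqAle eq_sym p_neq2 prime_gt1.
have pi0 := pi_gt0 R.
have : 0 < sin (2 * pi / p%:R) :> R.
  apply: sin_gt0_pi; rewrite divr_gt0 ?mulr_gt0 ?ltr0n ?prime_gt0 //=.
  by rewrite ltr_pdivrMr ?ltr0n ?prime_gt0 // mulrC ltr_pM2l.
by rewrite s0 ltxx.
Qed.

Lemma omega_prim : p.-primitive_root om.
Proof.
have [k omk kp] := prim_order_exists (prime_gt0 p_pr) omegaXp.
have /primeP[_ /(_ k kp)/orP[]/eqP ek] := p_pr; last by rewrite ek in omk.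
by case/eqP: omega_neq1; rewrite ek in omk; rewrite -[om]expr1 (prim_expr_order omk).
Qed.

Lemma omega_conj : om * Num.conj om = 1.
Proof.
rewrite -normCK -nsqE /nsq /=.
by rewrite cos2Dsin2.
Qed.

Lemma sum_rV1 (V : nmodType) (f : nat -> V) :
  \sum_(b : 'rV['F_p]_1) f (b ord0 ord0) = \sum_(k < p) f k.
Proof.
rewrite -(big_mkord xpredT f) -[X in index_iota 0 X](Fp_cast p_pr) big_mkord.
rewrite (reindex (fun k : 'F_p => \row_(_ < 1) k)) /=.
  by apply: eq_bigr => k _; rewrite mxE.
exists (fun b => b ord0 ord0) => [k _ | b _]; first by rewrite mxE.
by apply/matrixP => i j; rewrite mxE !ord1.
Qed.

(** With [z] the power of omega with exponent [a - a'], the inner product is a geometric sum over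
    [p] terms. It vanishes for [z != 1] because [z ^+ p = 1], and [z = 1] forces [a = a'] because
    omega is primitive. *)
Lemma QFTp_orthonormal (a a' : 'rV['F_p]_1) :
  \sum_b QFTp R b a * Num.conj (QFTp R b a') = (a == a')%:R.
Proof.
pose z := om ^+ (a ord0 ord0) * Num.conj (om ^+ (a' ord0 ord0)).
have E b : QFTp R b a * Num.conj (QFTp R b a') = z ^+ (b ord0 ord0) / p%:R.
  rewrite /QFTp rmorphM /= mulrACA [X in _ * X](_ : _ = z ^+ (b ord0 ord0)); last first.
    by rewrite exprMn -!rmorphXn /= -!exprM.
  rewrite mulrC; congr (_ * _); rewrite -normCK -nsqE /nsq /= expr0n addr0 exprVn sqr_sqrtr ?ler0n //.
  by rewrite fmorphV rmorph_nat.
under eq_bigr => b _ do rewrite E.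
rewrite -mulr_suml (sum_rV1 (fun k => z ^+ k)).
have pn0 : p%:R != 0 :> C by rewrite pnatr_eq0 -lt0n prime_gt0.
have [eaa'|naa'] := eqVneq a a'.
  have -> : z = 1 by rewrite /z -eaa' rmorphXn /= -exprMn omega_conj expr1n.
  by under eq_bigr => k _ do rewrite expr1n; rewrite sumr_const card_ord mulfV.
have zp : z ^+ p = 1.
  by rewrite exprMn -rmorphXn /= -!exprM ![(_ * p)%N]mulnC !exprM omegaXp !expr1n rmorph1 mulr1.
suff /eqP-> : \sum_(k < p) z ^+ k == 0 by rewrite mul0r.
have := subrX1 z p; rewrite zp subrr => /esym/eqP; rewrite mulf_eq0 subr_eq0.
case/orP => // /eqP z1; case/eqP: naa'; apply/matrixP => i j; rewrite (ord1 i) (ord1 j).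
have : om ^+ (a ord0 ord0) == om ^+ (a' ord0 ord0).
  rewrite -[X in X == _]mulr1 -(expr1n _ (a' ord0 ord0)) -omega_conj exprMn.
  by rewrite [om ^+ a' _ _ * _]mulrC mulrA -rmorphXn /= -/z z1 mul1r.
rewrite (eq_prim_root_expr omega_prim) !modn_small ?ltn_Fp // => /eqP e.
exact: val_inj.
Qed.

End FourierRoot.

(** * Circuits acting on a single register *)

Section Embedding.
Variables (R : realType) (N' N : nat) (iota : 'I_N' -> 'I_N).
Hypothesis emb_inj : injective iota.
Local Notation bits := {ffun 'I_N -> bool}.
Local Notation bits' := {ffun 'I_N' -> bool}.

Definition merge (b : bits) (b' : bits') : bits :=
  [ffun k => if [pick i | iota i == k] is Some i then b' i else b k].

Definition restr (b : bits) : bits' := [ffun i => b (iota i)].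

Definition embed (c : circuit R N') : circuit R N :=
  [seq (g.1.1, iota g.1.2, iota g.2) | g <- c].

Definition slice (psi : state R N) (b : bits) : state R N' :=
  [ffun b' => psi (merge b b')].

Lemma merge_emb b b' i : merge b b' (iota i) = b' i.
Proof.
rewrite ffunE; case: pickP => [k /eqP/emb_inj->//|/(_ i)].
by rewrite eqxx.
Qed.

Lemma merge_out b b' k : (forall i, iota i != k) -> merge b b' k = b k.
Proof. by move=> out; rewrite ffunE; case: pickP => // i; rewrite (negbTE (out i)). Qed.

Lemma eq_bits (b1 b2 : bits) : restr b1 = restr b2 ->
  (forall k, (forall i, iota i != k) -> b1 k = b2 k) -> b1 = b2.
Proof.
move=> er eo; apply/ffunP => k.
have [i /eqP<-|out] := pickP (fun i => iota i == k).
  by have /ffunP/(_ i) := er; rewrite !ffunE.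
by apply: eo => i; rewrite out.
Qed.

Lemma mergeK b b' : restr (merge b b') = b'.
Proof. by apply/ffunP => i; rewrite ffunE merge_emb. Qed.

Lemma merge_merge b b' b'' : merge (merge b b') b'' = merge b b''.
Proof. by apply: eq_bits => [|k out]; rewrite ?mergeK // !merge_out. Qed.

Lemma merge_restr b : merge b (restr b) = b.
Proof. by apply: eq_bits => [|k out]; rewrite ?mergeK // !merge_out. Qed.

Lemma merge_mergeK b b' : merge (merge b b') (restr b) = b.
Proof. by rewrite merge_merge merge_restr. Qed.

Lemma embed_wf c : circuit_wf c -> circuit_wf (embed c).
Proof.
rewrite /circuit_wf all_map; apply: sub_all => -[[U i] j].
by rewrite /gate_wf /= (inj_eq emb_inj).
Qed.

(** Embedded gates neither read nor change the qubits outside the range of [iota], so each slice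
    evolves on its own. *)
Lemma slice_run c psi b : slice (run (embed c) psi) b = run c (slice psi b).
Proof.
elim: c psi => //= -[[U i] j] c IHc psi; rewrite IHc; congr run.
apply/ffunP => b'; rewrite [LHS]ffunE [LHS]ffunE [RHS]ffunE.
apply: eq_bigr => x _; apply: eq_bigr => y _.
rewrite !merge_emb [slice _ _ _]ffunE; congr (_ * psi _).
apply: eq_bits => [|k out]; last first.
  by rewrite [RHS]merge_out // ffunE -!(eq_sym (iota _)) !(negbTE (out _)) merge_out.
by rewrite mergeK; apply/ffunP => l; rewrite [LHS]ffunE [LHS]ffunE [RHS]ffunE !(inj_eq emb_inj) merge_emb.
Qed.

(** [slice psi b] ignores the bits of [b] in the range of [iota], so each slice is counted once for
    every value of those bits. *)
Lemma sqn_slices (psi : state R N) :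
  \sum_b sqn (slice psi b) = sqn psi *+ #|{: bits'}|.
Proof.
rewrite -(sum_resample _ mergeK merge_mergeK).
by apply: eq_bigr => b _; apply: eq_bigr => b' _; rewrite ffunE.
Qed.

End Embedding.

(** * Encoded register states *)

Section Encoding.
Variables (R : realType) (p : nat).
Hypothesis p_pr : prime p.
Local Notation C := R[i].
Local Notation m := (qubits_per_reg p).

Definition Enc n N (gam : 'rV['F_p]_n -> C) : state R N :=
  \sum_x gam x *: ket R (enc_regs m N x).

Lemma enc_regs_in n N (x : 'rV['F_p]_n) (k : 'I_N) (j : 'I_n) i :
  (i < m)%N -> k = (j * m + i)%N :> nat -> enc_regs m N x k = odd (x ord0 j %/ 2 ^ i).
Proof.
move=> lt_i ek; rewrite ffunE -/(regbit x k) ek regbitE //.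
by rewrite reg_index_lt.
Qed.

Lemma enc_regs_out n N (x : 'rV['F_p]_n) (k : 'I_N) :
  (n * m <= k)%N -> enc_regs m N x k = false.
Proof. by move=> le_k; rewrite ffunE ltnNge le_k. Qed.

Lemma enc_regs_inj n N : (n * m <= N)%N -> injective (@enc_regs p n m N).
Proof.
move=> leN x y exy; apply/rowP => j; rewrite [LHS](Fp_bits p_pr) [RHS](Fp_bits p_pr).
apply: eq_bigr => i _; have lt_k : (j * m + i < N)%N.
  exact: leq_trans (reg_index_lt j (ltn_ord i)) leN.
have /ffunP/(_ (Ordinal lt_k)) := exy.
by rewrite !(@enc_regs_in _ _ _ (Ordinal lt_k) j i) // => ->.
Qed.

Lemma EncE n N (gam : 'rV['F_p]_n -> C) b :
  Enc N gam b = \sum_x gam x * (b == enc_regs m N x)%:R.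
Proof. by rewrite sum_ffunE; apply: eq_bigr => x _; rewrite !ffunE. Qed.

Lemma Enc_enc n N (gam : 'rV['F_p]_n -> C) x : (n * m <= N)%N ->
  Enc N gam (enc_regs m N x) = gam x.
Proof.
move=> leN; rewrite EncE (bigD1 x) //= eqxx mulr1 big1 ?addr0 // => y nyx.
by rewrite (inj_eq (enc_regs_inj leN)) eq_sym (negbTE nyx) mulr0.
Qed.

Lemma Enc_out n N (gam : 'rV['F_p]_n -> C) b :
  (forall x : 'rV['F_p]_n, b != enc_regs m N x) -> Enc N gam b = 0.
Proof. by move=> out; rewrite EncE big1 // => x _; rewrite (negbTE (out x)) mulr0. Qed.

Lemma sqn_Enc n N (gam : 'rV['F_p]_n -> C) : (n * m <= N)%N -> sqn (Enc N gam) = sqn gam.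
Proof.
move=> leN; transitivity (\sum_b \sum_x nsq (gam x) * (b == enc_regs m N x)%:R).
  apply: eq_bigr => b _.
  have [x /eqP-> | out] := pickP (fun x : 'rV['F_p]_n => b == enc_regs m N x).
    rewrite Enc_enc // (bigD1 x) //= eqxx mulr1 big1 ?addr0 // => y nyx.
    by rewrite (inj_eq (enc_regs_inj leN)) eq_sym (negbTE nyx) mulr0.
  rewrite Enc_out => [|x]; last by rewrite out.
  rewrite big1 => [|x _]; last by rewrite out mulr0.
  by rewrite /nsq /= expr0n addr0.
rewrite exchange_big; apply: eq_bigr => x _.
rewrite (bigD1 (enc_regs m N x)) //= eqxx mulr1 big1 ?addr0 // => b.
by move=> /negbTE->; rewrite mulr0.
Qed.

Lemma Enc_scale n N (a : C) (gam : 'rV['F_p]_n -> C) :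
  Enc N (fun x => a * gam x) = a *: Enc N gam.
Proof. by rewrite scaler_sumr; apply: eq_bigr => x _; rewrite scalerA. Qed.

Lemma eq_Enc n N (gam gam' : 'rV['F_p]_n -> C) : gam =1 gam' -> Enc N gam = Enc N gam'.
Proof. by move=> e; apply: eq_bigr => x _; rewrite e. Qed.

Definition apply_op n (W : 'rV['F_p]_n -> 'rV['F_p]_n -> C) gam y : C := \sum_x W y x * gam x.

(** [performs] speaks of unit vectors only, whereas slices have arbitrary norm. Nonzero vectors are
    normalized, and for the zero vector both outputs vanish. *)
Lemma performs_scaled n N (W : 'rV['F_p]_n -> 'rV['F_p]_n -> C) (c : circuit R N) (del : R) :
  0 <= del -> performs m W c del -> forall gam,
  sqn (run c (Enc N gam) - Enc N (apply_op W gam)) <= del ^+ 2 * sqn gam.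
Proof.
move=> del0 [leN cW] gam; have := sqn_ge0 gam.
rewrite le0r => /orP[/eqP g0 | g_gt0].
  have gam0 x : gam x = 0 * gam x.
    rewrite mul0r; apply: nsq_eq0; apply/eqP; rewrite eq_le nsq_ge0 andbT -g0.
    by rewrite /sqn (bigD1 x) //= lerDl sumr_ge0 // => *; apply: nsq_ge0.
  rewrite g0 mulr0 (eq_Enc _ gam0) Enc_scale scale0r linear0 sub0r.
  rewrite (@eq_Enc _ _ _ (fun y => 0 * apply_op W gam y)) => [|y].
    rewrite Enc_scale scale0r oppr0 (@eq_sqn _ _ _ (fun=> 0)) => [|b]; last by rewrite ffunE.
    by rewrite /sqn big1 // => b _; rewrite /nsq /= expr0n addr0.
  by rewrite mul0r /apply_op big1 // => x _; rewrite gam0 mul0r mulr0.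
pose s := Num.sqrt (sqn gam); have s0 : s != 0 by rewrite gt_eqF ?sqrtr_gt0.
have s2 : s ^+ 2 = sqn gam by rewrite sqr_sqrtr ?ltW.
pose t := real_complex R s^-1.
have nt : nsq t = (sqn gam)^-1 by rewrite /nsq /= expr0n addr0 exprVn s2.
have := cW (fun x => t * gam x).
rewrite -sqnE sqn_scale nt mulVf ?gt_eqF // => /(_ erefl).
rewrite vnorm_le // -/(Enc N _) Enc_scale linearZ /=.
rewrite -[X in _ - X]/(Enc N (apply_op W (fun x => t * gam x))).
rewrite [X in _ - X](@eq_Enc _ _ _ (fun y => t * apply_op W gam y)) => [|y]; last first.
  by rewrite /apply_op mulr_sumr; apply: eq_bigr => x _; rewrite mulrCA.
rewrite Enc_scale -scalerBr (@eq_sqn _ _ _ (fun b => t * (run c (Enc N gam) - Enc N (apply_op W gam)) b)).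
  by rewrite sqn_scale nt mulrC ler_pdivrMr.
by move=> b; rewrite [LHS]ffunE.
Qed.

End Encoding.

(** * One-register operators among n registers *)

Section RegisterPositions.
Variables (n m N' N : nat).
Hypothesis leN : (n * m + N' <= N)%N.
Implicit Types (j : 'I_n) (i : 'I_N').

Lemma reg_block_le j : (j * m + m <= n * m)%N.
Proof. by rewrite -mulSnr leq_mul2r ltn_ord orbT. Qed.

Lemma regpos_subproof j i : ((if (i < m)%N then j * m + i else n * m + (i - m)) < N)%N.
Proof. by have := reg_block_le j; have := ltn_ord i; case: ifP; lia. Qed.

(* Register [j] is the data register of a circuit on [N'] qubits whose
   ancillas go to the qubits following the [n] registers. *)
Definition regpos j i : 'I_N := Ordinal (regpos_subproof j i).

Lemma regpos_inj j : injective (regpos j).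
Proof.
move=> i i' /(congr1 val) /= e; apply: val_inj => /=; move: e.
by have := reg_block_le j; case: (ltnP i m); case: (ltnP i' m); lia.
Qed.

End RegisterPositions.

Section RegisterOps.
Variables (R : realType) (p n : nat).
Hypothesis p_pr : prime p.
Local Notation C := R[i].
Local Notation m := (qubits_per_reg p).
Implicit Types (x y z : 'rV['F_p]_n) (a : 'rV['F_p]_1) (bet : 'rV['F_p]_n -> C)
  (W : 'rV['F_p]_1 -> 'rV['F_p]_1 -> C) (j k : 'I_n).

Definition getreg j y : 'rV['F_p]_1 := \row__ y ord0 j.
Definition setreg j y a : 'rV['F_p]_n := \row_k (if k == j then a ord0 ord0 else y ord0 k).

(** The tensor product of [W] on register [j] with the identity on the others. *)
Definition regop W j bet y : C := \sum_a W (getreg j y) a * bet (setreg j y a).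

Lemma setregK j y a : getreg j (setreg j y a) = a.
Proof. by apply/matrixP => i l; rewrite !mxE eqxx !ord1. Qed.

Lemma setreg_setreg j y a a' : setreg j (setreg j y a) a' = setreg j y a'.
Proof. by apply/rowP => k; rewrite !mxE; case: eqP. Qed.

Lemma setreg_getreg j y : setreg j y (getreg j y) = y.
Proof. by apply/rowP => k; rewrite !mxE; case: eqP => // ->. Qed.

Lemma setreg_setregK j y a : setreg j (setreg j y a) (getreg j y) = y.
Proof. by rewrite setreg_setreg setreg_getreg. Qed.

Lemma regop_setreg W j bet y a :
  regop W j bet (setreg j y a) = apply_op W (fun a' => bet (setreg j y a')) a.
Proof. by rewrite /regop setregK; apply: eq_bigr => a' _; rewrite setreg_setreg. Qed.

Lemma sqn_regop W j bet : (forall gam, sqn (apply_op W gam) = sqn gam) ->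
  sqn (regop W j bet) = sqn bet.
Proof.
move=> Wiso; apply: (@mulIf _ #|{: 'rV['F_p]_1}|%:R).
  by rewrite pnatr_eq0 -lt0n; apply/card_gt0P; exists 0.
rewrite !mulr_natr -!(sum_resample _ (setregK j) (setreg_setregK j)).
apply: eq_bigr => y _; rewrite -[RHS]/(sqn (fun a => bet (setreg j y a))) -Wiso.
by apply: eq_bigr => a _; rewrite regop_setreg.
Qed.

Section Circuit.
Variables (N' N : nat).
Hypothesis leN' : (1 * m <= N')%N.
Hypothesis leN : (n * m + N' <= N)%N.

Local Notation regpos := (regpos leN).

Lemma restr_enc j x : restr (regpos j) (enc_regs m N x) = enc_regs m N' (getreg j x).
Proof.
apply/ffunP => i; rewrite [LHS]ffunE; case: (ltnP i m) => im.
  rewrite (@enc_regs_in p _ _ _ _ j i) //= ?im // (@enc_regs_in p _ _ _ _ ord0 i) //.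
  by rewrite mxE.
by rewrite !enc_regs_out // ?mul1n //= ltnNge im /= leq_addr.
Qed.

Lemma regpos_off j (i : nat) (k' : 'I_N) (k : 'I_n) : (i < m)%N ->
  k' = (k * m + i)%N :> nat -> (forall l, regpos j l != k') -> k != j.
Proof.
move=> im ek out; apply/eqP => ekj; have lt_i : (i < N')%N by lia.
have /eqP := out (Ordinal lt_i); apply; apply: val_inj => /=.
by rewrite im ek ekj.
Qed.

Lemma merge_enc j x a :
  merge (regpos j) (enc_regs m N x) (enc_regs m N' a) = enc_regs m N (setreg j x a).
Proof.
apply: (@eq_bits _ _ (regpos j)) => [|k out].
  by rewrite mergeK ?restr_enc ?setregK //; apply: regpos_inj.
rewrite merge_out //; case: (ltnP k (n * m)%N) => lt_k; last by rewrite !enc_regs_out.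
have m0 : (0 < m)%N by exact: qubits_per_reg_gt0.
have lt_j : (k %/ m < n)%N by rewrite ltn_divLR.
have ek : k = (Ordinal lt_j * m + k %% m)%N :> nat by rewrite /= -divn_eq.
have lt_i : (k %% m < m)%N by rewrite ltn_mod.
rewrite !(enc_regs_in _ lt_i ek) mxE.
by rewrite (negbTE (regpos_off lt_i ek out)).
Qed.

Lemma slice_Enc_enc j bet x :
  slice (regpos j) (Enc N bet) (enc_regs m N x) = Enc N' (fun a => bet (setreg j x a)).
Proof.
have leN0 : (n * m <= N)%N by apply: leq_trans leN; apply: leq_addr.
apply/ffunP => b'; rewrite [LHS]ffunE.
have [a /eqP-> | out] := pickP (fun a : 'rV['F_p]_1 => b' == enc_regs m N' a).
  by rewrite merge_enc !Enc_enc.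
rewrite !Enc_out // => [a|y]; first by rewrite out.
apply/eqP => /(congr1 (restr (regpos j))); rewrite mergeK; last exact: regpos_inj.
by rewrite restr_enc => /eqP; rewrite out.
Qed.

(** If [b] agrees with an encoded [x] outside the positions of register [j], the slices are
    encodings over register [j] alone; otherwise both vanish. *)
Lemma slice_Enc_regop W j bet b : exists gam,
  slice (regpos j) (Enc N bet) b = Enc N' gam /\
  slice (regpos j) (Enc N (regop W j bet)) b = Enc N' (apply_op W gam).
Proof.
have [x /eqP ex | out] := pickP (fun x : 'rV['F_p]_n =>
    b == merge (regpos j) (enc_regs m N x) (restr (regpos j) b)).
  exists (fun a => bet (setreg j x a)); rewrite ex.
  have e psi : slice (regpos j) psi (merge (regpos j) (enc_regs m N x) (restr (regpos j) b)) =
               slice (regpos j) psi (enc_regs m N x) :> state R N'.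
    by apply/ffunP => b'; rewrite !ffunE merge_merge //; apply: regpos_inj.
  split; first by rewrite e slice_Enc_enc.
  by rewrite e slice_Enc_enc; apply: eq_Enc => a; rewrite regop_setreg.
(* Writing [0 * 0] presents the zero family as a scalar multiple, ready for [Enc_scale]. *)
have zero (bet' : 'rV['F_p]_n -> C) :
    slice (regpos j) (Enc N bet') b = Enc N' (fun _ : 'rV['F_p]_1 => 0 * 0).
  rewrite Enc_scale scale0r; apply/ffunP => b'; rewrite [LHS]ffunE [RHS]ffunE.
  apply: Enc_out => x; apply/eqP => ex; have := out x.
  rewrite -ex merge_merge; last exact: regpos_inj.
  by rewrite merge_restr ?eqxx //; apply: regpos_inj.
exists (fun=> 0 * 0); split=> //; rewrite zero; apply: eq_Enc => a.
by rewrite /apply_op big1 ?mul0r // => a' _; rewrite mulr0.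
Qed.

(** Bound the error on each slice by [performs_scaled], sum over the slices and cancel their common
    multiplicity. *)
Lemma regop_error W j bet (c : circuit R N') (del : R) : 0 <= del ->
  performs m W c del ->
  sqn (run (embed (regpos j) c) (Enc N bet) - Enc N (regop W j bet)) <= del ^+ 2 * sqn bet.
Proof.
move=> del0 cW; have leN0 : (n * m <= N)%N by apply: leq_trans leN; apply: leq_addr.
have c0 : 0 < #|{: {ffun 'I_N' -> bool}}|%:R :> R.
  by rewrite ltr0n; apply/card_gt0P; exists [ffun=> false].
rewrite -(ler_pM2r c0) -mulrA !mulr_natr -(sqn_Enc p_pr bet leN0).
rewrite -!(sqn_slices (regpos_inj (leN := leN) (j := j))) mulr_sumr; apply: ler_sum => b _.
have [gam [e1 e2]] := slice_Enc_regop W j bet b.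
rewrite e1 sqn_Enc //; apply: le_trans (performs_scaled del0 cW gam).
rewrite -e1 -e2 -slice_run; last exact: regpos_inj.
by apply: ler_sum => b' _; rewrite !ffunE.
Qed.

Definition regops W (js : seq 'I_n) bet := foldl (fun bet' j => regop W j bet') bet js.

(** The error [d] of the first transform passes through the remaining circuit [cs] with its norm
    unchanged, so each register adds at most [del]. Ancillas are shared by all transforms; their
    deviation from 0 is part of the error. *)
Lemma regops_error W (js : seq 'I_n) bet (c : circuit R N') (del : R) : 0 <= del ->
  circuit_wf c -> performs m W c del -> (forall gam, sqn (apply_op W gam) = sqn gam) ->
  sqn bet = 1 ->
  sqn (run (flatten [seq embed (regpos j) c | j <- js]) (Enc N bet)
       - Enc N (regops W js bet)) <= ((size js)%:R * del) ^+ 2.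
Proof.
move=> del0 cw cW Wiso; elim: js bet => [|j js IHjs] bet b1 /=.
  rewrite subrr mul0r expr0n /= /sqn big1 // => b _.
  by rewrite ffunE /nsq /= expr0n addr0.
rewrite run_cat -natr1 mulrDl mul1r [_ * del + del]addrC.
set cs := flatten _; set bet' := regop W j bet.
have b1' : sqn bet' = 1 by rewrite sqn_regop.
have cs_wf : circuit_wf cs.
  rewrite /cs; elim: (js) => //= k js' IH.
  by rewrite circuit_wf_cat IH embed_wf //; apply: regpos_inj.
pose d := run (embed (regpos j) c) (Enc N bet) - Enc N bet'.
rewrite (@eq_sqn _ _ _ (fun b => run cs d b + (run cs (Enc N bet') - Enc N (regops W js bet')) b)).
  apply: sqn_triangle => //; first by rewrite mulr_ge0.
    by rewrite sqn_run //; have := regop_error j bet del0 cW; rewrite b1 mulr1.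
  exact: IHjs.
by move=> b; rewrite linearB !ffunE /=; ring.
Qed.

End Circuit.

(** Operators on distinct registers form a tensor product. Peeling off the last register [j] splits
    the sum over [z] by the content of that register. *)
Lemma regopsE W (js : seq 'I_n) bet y : uniq js ->
  regops W js bet y = \sum_(z : 'rV['F_p]_n | [forall k, (k \notin js) ==> (z ord0 k == y ord0 k)])
    (\prod_(k <- js) W (getreg k y) (getreg k z)) * bet z.
Proof.
elim/last_ind: js y => [|js j IHjs] y /=.
  rewrite (big_pred1 y) ?big_nil ?mul1r // => z.
  apply/forallP/eqP => [e|-> k]; last by rewrite eqxx.
  by apply/rowP => k; apply/eqP; have := e k.
rewrite rcons_uniq => /andP[jjs ujs]; rewrite /regops foldl_rcons -/(regops W js bet).
rewrite (partition_big (getreg j) xpredT) //=; apply: eq_bigr => a _.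
rewrite IHjs // mulr_sumr; apply: eq_big => [z|z /forallP ez].
  apply/forallP/andP => [e | [/forallP e /eqP ea] k].
    split; last first.
      by apply/eqP/matrixP => i l; have := e j; rewrite !mxE eqxx jjs /= !ord1 => /eqP->.
    apply/forallP => k; apply/implyP; rewrite mem_rcons inE negb_or => /andP[kj kjs].
    by have := e k; rewrite kjs mxE (negbTE kj).
  apply/implyP => kjs; rewrite mxE; case: (k =P j) => [->|/eqP kj].
    by rewrite -ea mxE.
  by have := e k; rewrite mem_rcons inE negb_or kj kjs.
have za : getreg j z = a.
  by apply/matrixP => i l; have := ez j; rewrite !mxE eqxx jjs /= !ord1 => /eqP->.
rewrite -cats1 big_cat big_seq1 za mulrA; congr (_ * _).
rewrite mulrC; congr (_ * _); rewrite big_seq [RHS]big_seq; apply: eq_bigr => k kjs.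
congr W; apply/matrixP => i l; rewrite !mxE.
by case: eqP kjs jjs => // -> ->.
Qed.

End RegisterOps.

(** * The bilinear form of phi *)

Section TraceForm.
Variables (p n : nat) (P : {poly 'F_p}) (phi : 'rV['F_p]_n -> 'F_p).
Implicit Types x y z : 'rV['F_p]_n.

Lemma Fp_linearE (f : 'rV['F_p]_n -> 'F_p) x : Fp_linear f ->
  f x = \sum_j x ord0 j * f (delta_mx ord0 j).
Proof.
move=> f_lin.
have fD y z : f (y + z) = f y + f z by have := f_lin 1 y z; rewrite scale1r mul1r.
have f0 : f 0 = 0 by apply: (addrI (f 0)); rewrite -fD !addr0.
have fZ a y : f (a *: y) = a * f y by have := f_lin a y 0; rewrite !addr0 f0 addr0.
rewrite {1}(row_sum_delta x) (big_morph f fD f0).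
by apply: eq_bigr => j _; rewrite fZ.
Qed.

Lemma gf_mulC x y : gf_mul P x y = gf_mul P y x.
Proof. by rewrite /gf_mul mulrC. Qed.

Lemma gf_mul_linear x : linear (gf_mul P x).
Proof. by move=> a y z; rewrite /gf_mul linearP mulrDr -scalerAr modpD modpZl linearP. Qed.

(** The Gram matrix of the bilinear form [phi (x y)] in the standard basis. *)
Definition form_mx : 'M['F_p]_n :=
  \matrix_(i, j) phi (gf_mul P (delta_mx ord0 i) (delta_mx ord0 j)).

Hypothesis phi_lin : Fp_linear phi.

Lemma form_mxE x y : phi (gf_mul P x y) = \sum_j (x *m form_mx) ord0 j * y ord0 j.
Proof.
rewrite (@Fp_linearE (fun y => phi (gf_mul P x y))) => [|a y1 y2]; last first.
  by rewrite gf_mul_linear phi_lin.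
apply: eq_bigr => j _; rewrite mulrC; congr (_ * _).
rewrite (@Fp_linearE (fun x => phi (gf_mul P x (delta_mx ord0 j)))) => [|a x1 x2]; last first.
  by rewrite !(gf_mulC _ (delta_mx ord0 j)) gf_mul_linear phi_lin.
by rewrite mxE; apply: eq_bigr => i _; rewrite mxE.
Qed.

Hypotheses (P_irr : irreducible_poly P) (sP : size P = n.+1).

(** A nonzero [x] has degree below that of the irreducible [P], so the two are coprime and a Bezout
    coefficient [v] inverts [x] modulo [P]; take [y] to be [v z] reduced. *)
Lemma gf_div x z : x != 0 -> exists y, gf_mul P x y = z.
Proof.
move=> x0; have rx0 : rVpoly x != 0.
  by apply: contra_neq x0 => e; rewrite -[x]rVpolyK e linear0.
have sx : (size (rVpoly x) < size P)%N by rewrite sP ltnS size_poly.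
have /Bezout_eq1_coprimepP[[u v] /= uv] : coprimep P (rVpoly x).
  rewrite /coprimep; apply/idPn => sg.
  have /eqp_dvdl eg := P_irr.2 _ sg (dvdp_gcdl P (rVpoly x)).
  have := dvdp_gcdr P (rVpoly x); rewrite eg => /(dvdp_leq rx0).
  by rewrite leqNgt sx.
have P0 : P != 0 by apply: irredp_neq0.
exists (poly_rV ((v * rVpoly z) %% P)); rewrite /gf_mul poly_rV_K; last first.
  by rewrite -ltnS -sP ltn_modp.
rewrite modp_mul; have -> : rVpoly x * (v * rVpoly z) = rVpoly z - u * rVpoly z * P.
  by rewrite -[X in _ = X - _]mul1r -uv; ring.
rewrite modpD modpN modp_mull oppr0 addr0 modp_small ?rVpolyK //.
by rewrite sP ltnS size_poly.
Qed.

(** If [x] is in the kernel, [phi] vanishes on all multiples of [x]. For nonzero [x] these include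
    [z], where [phi] does not vanish. *)
Lemma form_mx_unit : (exists x, phi x != 0) -> form_mx \in unitmx.
Proof.
move=> [z phiz]; rewrite -row_free_unit; apply: inj_row_free => x x0.
apply/eqP; apply: contraNT phiz => /gf_div-/(_ z)[y <-].
by rewrite form_mxE x0 big1 // => j _; rewrite mxE mul0r.
Qed.

End TraceForm.

Lemma QFTp_isometry (R : realType) p (gam : 'rV['F_p]_1 -> R[i]) : prime p ->
  sqn (apply_op (@QFTp R p) gam) = sqn gam.
Proof.
move=> p_pr; apply: (@complexI R); rewrite !sqnE.
by apply: isometry_norm => a a'; apply: QFTp_orthonormal.
Qed.

Lemma prod_QFTp (R : realType) p n (P : {poly 'F_p}) phi (x y : 'rV['F_p]_n) :
  prime p -> Fp_linear phi ->
  \prod_(k <- enum 'I_n) QFTp R (getreg k y) (getreg k (x *m form_mx P phi)) =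
  Fq_phi R P phi y x.
Proof.
move=> p_pr phi_lin; rewrite big_enum /= big_split /= prodr_const card_ord; congr (_ * _).
  rewrite -rmorphXn /= exprVn; congr (_ _^-1).
  rewrite natrX; elim: n {P phi x y phi_lin} => [|n IHn]; first by rewrite !expr0 sqrtr1.
  by rewrite !exprS sqrtrM ?ler0n // IHn.
rewrite prodrXr [in RHS]form_mxE //.
(* The collected exponent is a natural number; it matters only modulo [p], where it is the form of
   [form_mxE]. *)
set s := (\sum_i _)%N; rewrite -(prim_expr_mod (omega_prim R p_pr) s); congr (_ ^+ _).
rewrite -(val_Fp_nat p_pr); congr (nat_of_ord _).
rewrite natr_sum; apply: eq_bigr => k _.
by rewrite natrM !mxE !natr_FpK.
Qed.

Theorem theorem2 :
  exists c0 : nat,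
  forall (R : realType) (p n : nat) (P : {poly 'F_p})
         (phi : 'rV['F_p]_n -> 'F_p) (eps : R) (k : nat),
    prime p ->
    irreducible_poly P -> size P = n.+1 ->
    Fp_linear phi -> (exists x, phi x != 0) ->
    0 <= eps ->
    QFT_achievable p (eps / n%:R) k ->
    exists (N : nat) (c : circuit R N),
      [/\ circuit_wf c,
          (size c <= c0 * n ^ 2 * qubits_per_reg p ^ 2 + n * k)%N
        & performs (qubits_per_reg p) (@Fq_phi R p n P phi) c eps].
Proof.
exists 504%N => R p n P phi eps k p_pr P_irr sP phi_lin phi_nz eps0.
move=> [N' [c [cw [sc cQ]]]]; set m := qubits_per_reg p.
have n0 : (0 < n)%N by have := P_irr.1; rewrite sP.
have nR0 : n%:R != 0 :> R by rewrite pnatr_eq0 -lt0n.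
have del0 : 0 <= eps / n%:R by rewrite divr_ge0 ?ler0n.
pose A := form_mx P phi; have uA : A \in unitmx by apply: form_mx_unit.
(* Data registers, room for the ancillas of [c], and the qubits required by [reach_mulmx]. *)
pose N := (n * m + N' + 28 * n ^ 2 * m ^ 2)%N.
have leN' : (1 * m <= N')%N by case: cQ.
have leN : (n * m + N' <= N)%N by apply: leq_addr.
have [c1 [c1w sc1 c1E]] : reach R (504 * n ^ 2 * m ^ 2) (fun x => enc_regs m N x)
    (fun x => enc_regs m N (x *m A)).
  by apply: (@reach_mulmx p 'rV['F_p]_n p_pr n R N A id) => //; apply: leq_addl.
exists N, (c1 ++ flatten [seq embed (regpos leN j) c | j <- enum 'I_n]).
split.
- rewrite circuit_wf_cat c1w; elim: (enum _) => //= j js IH.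
  by rewrite circuit_wf_cat embed_wf //; apply: regpos_inj.
- rewrite size_cat leq_add // -[n in (n * k)%N](size_enum_ord n).
  by elim: (enum _) => //= j js IH; rewrite size_cat size_map sc mulSn leq_add2l.
split=> [|alpha alpha1]; first by apply: leq_trans leN; apply: leq_addr.
rewrite vnorm_le // run_cat.
(* The amplitudes after the linear map. *)
pose bet z := alpha (z *m invmx A).
have Abij : bijective (fun x : 'rV['F_p]_n => x *m A).
  by exists (fun x => x *m invmx A) => x; rewrite (mulmxK, mulmxKV).
have betA x : bet (x *m A) = alpha x by rewrite /bet mulmxK.
have -> : run c1 (\sum_x alpha x *: ket R (enc_regs m N x)) = Enc N bet.
  rewrite linear_sum /Enc [RHS](reindex _ (onW_bij _ Abij)).
  by apply: eq_bigr => x _; rewrite linearZ /= c1E betA.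
have bet1 : sqn bet = 1.
  apply: (@complexI R); rewrite sqnE rmorph1 -alpha1 [LHS](reindex _ (onW_bij _ Abij)).
  by apply: eq_bigr => x _; rewrite betA.
rewrite [X in _ - X](_ : _ = Enc N (regops (@QFTp R p) (enum 'I_n) bet)).
  have := regops_error p_pr leN' leN (enum 'I_n) del0 cw cQ
    (fun gam => QFTp_isometry gam p_pr) bet1.
  by rewrite size_enum_ord [n%:R * _]mulrC divfK.
(* With all registers transformed, the side condition of [regopsE] is void, and the substitution of
   [x *m A] for the summation index produces the entries of [Fq_phi]. *)
apply/esym/eq_Enc => y; rewrite regopsE ?enum_uniq // (reindex _ (onW_bij _ Abij)) /=.
apply: eq_big => [x|x _]; first by apply/forallP => j; rewrite mem_enum.
by rewrite prod_QFTp // betA.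
Qed.
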